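(* Let $\mathcal{A}$ and $\mathcal{B}$ be alphabets of size at least 2. A non-erasing morphism $\sigma : \mathcal{A}^* \to \mathcal{B}^*$ is dendric preserving if and only if it is, up to a bijective coding, in the monoid $AR_{\mathcal{A}}$ generated by the Arnoux-Rauzy morphisms over $\mathcal{A}$ (that is, $\sigma = \pi \circ \tau$ for some $\tau \in AR_{\mathcal{A}}$ and some bijective coding $\pi : \mathcal{A}^* \to \mathcal{B}^*$).
   Context: A morphism $\sigma : \mathcal{A}^* \to \mathcal{B}^*$ is a monoid homomorphism, with the convention that every letter of $\mathcal{B}$ appears in the image under $\sigma$ of some letter. It is non-erasing if no letter is mapped to the empty word; it then extends to bi-infinite words. A bijective coding is a morphism mapping letters to single letters, with distinct letters having distinct images (by the convention it induces a bijection of alphabets). A bi-infinite word $x \in \mathcal{A}^{\mathbb{Z}}$ is ''over $\mathcal{A}$'' if every letter of $\mathcal{A}$ appears in $x$. For a factor $w$ of $x$ (including the empty word), the extension graph of $w$ is the undirected bipartite graph whose vertex set is the disjoint union of $\{a \mid aw \text{ is a factor of } x\}$ and $\{b \mid wb \text{ is a factor of } x\}$, with an edge between the left vertex $a$ and the right vertex $b$ iff $awb$ is a factor of $x$. The bi-infinite word $x$ is dendric if the extension graphs of all its factors are trees. The morphism $\sigma$ is dendric preserving if $\sigma(x)$ is dendric for every dendric bi-infinite word $x$ over $\mathcal{A}$. The Arnoux-Rauzy morphisms over $\mathcal{A}$ are, for $\ell \in \mathcal{A}$, the morphisms $L_\ell, R_\ell : \mathcal{A}^*\to\mathcal{A}^*$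 defined by $L_\ell(\ell) = R_\ell(\ell) = \ell$ and $L_\ell(a) = \ell a$, $R_\ell(a) = a \ell$ for $a \in \mathcal{A} \setminus \{\ell\}$. $AR_{\mathcal{A}}$ is the monoid (under composition, containing the identity) generated by all $L_\ell, R_\ell$, $\ell \in \mathcal{A}$. *)

(* Defs.v *)
From mathcomp Require Import all_boot all_order all_algebra.
From mathcomp Require Import boolp.

Set Implicit Arguments.
Unset Strict Implicit.
Unset Printing Implicit Defensive.

Import GRing.Theory.
Local Open Scope ring_scope.

(** * Morphisms of free monoids *)

(* The third component is the convention that every letter of the target
   alphabet appears in the image of some letter. *)
Definition is_morphism (A B : finType) (s : seq A -> seq B) : Prop :=
  [/\ s [::] = [::],
      forall u v : seq A, s (u ++ v) = s u ++ s v
    & forall b : B, exists a : A, b \in s [:: a]].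

Definition non_erasing (A B : finType) (s : seq A -> seq B) : Prop :=
  forall a : A, s [:: a] <> [::].

Definition bijective_coding (A B : finType) (p : seq A -> seq B) : Prop :=
  is_morphism p /\
  exists2 f : A -> B, injective f & forall a : A, p [:: a] = [:: f a].

(** * Bi-infinite words *)

Definition word_over (A : finType) (x : int -> A) : Prop :=
  forall a : A, exists i : int, x i = a.

(* The word x_i x_(i+1) ... x_(i+n-1). *)
Definition window (A : Type) (x : int -> A) (i : int) (n : nat) : seq A :=
  mkseq (fun k : nat => x (i + k%:Z)) n.

Definition is_factor (A : Type) (x : int -> A) (w : seq A) : Prop :=
  exists i : int, window x i (size w) = w.

(* y = ... s(x_(-2)) s(x_(-1)) . s(x_0) s(x_1) ..., the dot standing for the
   position before the letter of index 0.  When s is a non-erasing morphism,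
   exactly one y satisfies this: see [is_image_exists], [is_image_unique]. *)
Definition is_image (A B : finType) (s : seq A -> seq B)
    (x : int -> A) (y : int -> B) : Prop :=
  forall n : nat,
    (let u := s (window x 0 n) in window y 0 (size u) = u) /\
    (let v := s (window x (- n%:Z) n) in window y (- (size v)%:Z) (size v) = v).

(** * Dendric words *)

(* The undirected graph on the vertex set V, with adjacency e (a symmetric
   relation) restricted to V, is nonempty, connected and has no cycle. *)
Definition is_tree (T : finType) (V : {set T}) (e : rel T) : Prop :=
  let eV := [rel u v in V | e u v] in
  [/\ V != set0,
      {in V &, forall u v : T, connect eV u v}
    & forall c : seq T, (2 < size c)%N -> ~ ucycle eV c].

(* Left vertices are tagged by inl, right vertices by inr. *)
Definition ext_vertices (A : finType) (x : int -> A) (w : seq A) :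
    {set A + A} :=
  [set u : A + A | match u with
                   | inl a => `[< is_factor x (a :: w) >]
                   | inr b => `[< is_factor x (rcons w b) >]
                   end].

Definition ext_edges (A : finType) (x : int -> A) (w : seq A) : rel (A + A) :=
  fun u v => match u, v with
             | inl a, inr b | inr b, inl a =>
                 `[< is_factor x (a :: rcons w b) >]
             | _, _ => false
             end.

Definition dendric (A : finType) (x : int -> A) : Prop :=
  forall w : seq A, is_factor x w ->
    is_tree (ext_vertices x w) (ext_edges x w).

Definition dendric_preserving (A B : finType) (s : seq A -> seq B) : Prop :=
  forall x : int -> A, word_over x -> dendric x ->
  forall y : int -> B, is_image s x y -> dendric y.

(** * Arnoux-Rauzy morphisms *)

Definition extend (A B : finType) (f : A -> seq B) : seq A -> seq B :=
  fun w => flatten (map f w).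

Definition AR_L (A : finType) (l : A) : seq A -> seq A :=
  extend (fun a => if a == l then [:: l] else [:: l; a]).

Definition AR_R (A : finType) (l : A) : seq A -> seq A :=
  extend (fun a => if a == l then [:: l] else [:: a; l]).

Inductive AR_monoid (A : finType) : (seq A -> seq A) -> Prop :=
| AR_monoid_id : AR_monoid (fun w => w)
| AR_monoid_L (l : A) : AR_monoid (AR_L l)
| AR_monoid_R (l : A) : AR_monoid (AR_R l)
| AR_monoid_comp (s t : seq A -> seq A) :
    AR_monoid s -> AR_monoid t -> AR_monoid (s \o t).

(** * Images of bi-infinite words are well defined *)

Lemma size_window (A : Type) (x : int -> A) i n : size (window x i n) = n.
Proof. by rewrite size_mkseq. Qed.

Lemma window_cat (A : Type) (x : int -> A) i m n :
  window x i (m + n) = window x i m ++ window x (i + m%:Z) n.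
Proof.
rewrite /window /mkseq iotaD map_cat; congr (_ ++ _).
rewrite add0n -[in iota m n](addn0 m) iotaDl -map_comp.
by apply: eq_map => k /=; rewrite PoszD addrA.
Qed.

Section Images.
Variables (A B : finType) (s : seq A -> seq B).
Hypotheses (s_mor : is_morphism s) (s_ne : non_erasing s).

Lemma leq_size_image w : (size w <= size (s w))%N.
Proof.
case: s_mor => s0 sM _.
elim: w => [|a w IHw] //=; rewrite -cat1s sM size_cat -add1n leq_add //.
by case: (s [:: a]) (s_ne (a := a)).
Qed.

Lemma is_image_exists (x : int -> A) : exists y : int -> B, is_image s x y.
Proof.
case: s_mor => s0 sM _.
have [b0 _] : exists b : B, True by case: (s [:: x 0]) (@s_ne (x 0)) => // b; exists b.
pose P n := s (window x 0 n); pose Q n := s (window x (- n%:Z) n).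
have sP n : (n <= size (P n))%N.
  by rewrite -[leqLHS](size_window x 0) leq_size_image.
have sQ n : (n <= size (Q n))%N.
  by rewrite -[leqLHS](size_window x (- n%:Z)) leq_size_image.
have nthP m n k : (m <= n)%N -> (k < size (P m))%N ->
    nth b0 (P n) k = nth b0 (P m) k.
  by move=> /subnKC <- km; rewrite /P window_cat sM nth_cat km.
have nthQ m n k : (m <= n)%N -> (k < size (Q m))%N ->
    nth b0 (rev (Q n)) k = nth b0 (rev (Q m)) k.
  move=> /subnK mn km; rewrite /Q -[X in window _ _ X]mn window_cat sM.
  rewrite (_ : - n%:Z + (n - m)%N%:Z = - m%:Z); last first.
    by rewrite -[in X in - X]mn PoszD opprD addrAC addNr add0r.
  by rewrite rev_cat nth_cat size_rev km.
have same (F : nat -> seq B) m n k :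
    (forall m n k, (m <= n)%N -> (k < size (F m))%N ->
      nth b0 (F n) k = nth b0 (F m) k) ->
    (k < size (F m))%N -> (k < size (F n))%N ->
    nth b0 (F n) k = nth b0 (F m) k.
  by move=> FP km kn; case/orP: (leq_total m n) => mn;
     [apply: FP | apply/esym/FP].
exists (fun i => match i with
                 | Posz k => nth b0 (P k.+1) k
                 | Negz k => nth b0 (rev (Q k.+1)) k end) => n /=; split.
  rewrite -/(P n); apply: (@eq_from_nth _ b0); rewrite size_window // => k kn.
  by rewrite nth_mkseq // add0r; apply: same => //; apply: sP.
rewrite -/(Q n); apply: (@eq_from_nth _ b0); rewrite size_window // => k kn.
rewrite nth_mkseq //.
have -> : - (size (Q n))%:Z + k%:Z = Negz (size (Q n) - k.+1).
  by rewrite NegzE -subSn // subSS -subzn 1?ltnW // opprB addrC.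
have jn : (size (Q n) - k.+1 < size (Q n))%N.
  by rewrite ltn_subrL /=; apply: leq_ltn_trans kn.
rewrite (same (fun n => rev (Q n)) n) ?size_rev //; last first.
  - by move=> m1 n1 k1 mn; rewrite size_rev; apply: nthQ.
by rewrite nth_rev // subnSK // subKn // ltnW.
Qed.

Lemma is_image_unique (x : int -> A) (y z : int -> B) :
  is_image s x y -> is_image s x z -> y =1 z.
Proof.
move=> yP zP i.
have eqw j m k : window y j m = window z j m -> (k < m)%N ->
    y (j + k%:Z) = z (j + k%:Z).
  move=> e km; have := congr1 (fun w => nth (y (j + k%:Z)) w k) e.
  by rewrite !nth_mkseq.
case: i => n.
  have [/= yn _] := yP n.+1; have [/= zn _] := zP n.+1.
  rewrite -[Posz n]add0r; apply: (eqw _ _ _ (etrans yn (esym zn))).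
  by rewrite -[leqLHS](size_window x 0) leq_size_image.
have [/= _ yn] := yP n.+1; have [/= _ zn] := zP n.+1.
set v := s _ in yn zn.
have nv : (n < size v)%N.
  by rewrite -[leqLHS](size_window x (- n.+1%:Z)) leq_size_image.
have -> : Negz n = - (size v)%:Z + (size v - n.+1)%N%:Z.
  by rewrite NegzE -subzn // addrA addNr add0r.
apply: (eqw _ _ _ (etrans yn (esym zn))).
by rewrite ltn_subrL /=; apply: leq_ltn_trans nv.
Qed.

End Images.

(* Main.v *)
Require Import Defs.
From mathcomp Require Import all_boot all_order all_algebra.
From mathcomp Require Import boolp zify.

(** Everything is read off the set L(x) of factors of a word x.

    Images under L_l are decoded by cutting before each letter l: the extension
    graph of a factor of L_l(x) is a double star (one left vertex and one right
    vertex cover all the edges) or is literally the extension graph of a shorter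
    factor of x.  So L_l and R_l preserve dendricity and reflect it, and a fixed
    point of the product of all L_l has only double stars.

    Conversely, let sigma be dendric preserving.  Trees enter the argument in
    two ways only: they contain no 4-cycle, and they are connected.
    - Connectedness: a state S(i) of the position i which is updated letter by
      letter and determined by a bounded window is constant.  For the state
      "sum of the weights of the letters so far" this gives |B| <= |A|; for a
      periodic word it shows that some sigma(ab) <> sigma(ba).
    - No 4-cycle: take a, b with sigma(ab) <> sigma(ba) and let s (resp. p) be
      the longest common suffix (prefix) of the images of letters under
      sigma L_a L_b (resp. sigma R_a R_b).  The letters z of x survive in the
      image as letters g(z), f(z) around w = s sigma(aba) p, and a dendric word
      with a path a - c - d - d - b in its graph forces g and f to be injective,
      hence bijective.  So w extends by all letters on both sides, and the first
      and the last letter of w are centres of the extension graph of the empty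
      word.
    Applied to sigma L_c, this gives a letter l_c such that the pairs of
    consecutive letters of the words sigma(cz), sigma(zc) are exactly those
    containing l_c.  If l_c does not depend on c, all images of letters begin
    with l or all end with l, sigma factors on the left through L_l or R_l, and
    one concludes by induction on the total length.  Otherwise all images have
    length one, except that for |A| = 2 the images may a priori be alternating
    words p(qp)^i, q(pq)^j, which another 4-cycle excludes. *)

Set Implicit Arguments.
Unset Strict Implicit.
Unset Printing Implicit Defensive.

Import GRing.Theory.

(** * Factors and images *)

Section Factors.
Variables (A : finType) (x : int -> A).
Implicit Types (w u v : seq A) (a b : A).

Lemma windowS i n : window x i n.+1 = x i :: window x (i + 1)%R n.
Proof. by rewrite -add1n window_cat /window /mkseq /= addr0. Qed.

Lemma windowSr i n : window x i n.+1 = rcons (window x i n) (x (i + n%:Z)%R).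
Proof. by rewrite -addn1 window_cat cats1 /window /mkseq /= addr0. Qed.

Lemma infix_window j k m n : k + n <= m ->
  infix (window x (j + k%:Z)%R n) (window x j m).
Proof.
move=> knm; rewrite -(subnKC knm) -addnA !window_cat.
by apply/infixP; eexists _, _; reflexivity.
Qed.

Lemma window_factor i n : is_factor x (window x i n).
Proof. by exists i; rewrite size_window. Qed.

Lemma factor_infix w u : infix w u -> is_factor x u -> is_factor x w.
Proof.
case/infixP=> p [q ->] [i]; rewrite !size_cat !window_cat => /eqP.
rewrite eqseq_cat ?size_window // eqseq_cat ?size_window // => /and3P[_ /eqP e _].
by eexists; exact: e.
Qed.

Lemma factor_pre u v : is_factor x (u ++ v) -> is_factor x u.
Proof. by apply: factor_infix; rewrite prefix_infix // prefix_prefix. Qed.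

Lemma factor_suf u v : is_factor x (u ++ v) -> is_factor x v.
Proof. by apply: factor_infix; rewrite suffix_infix // suffix_suffix. Qed.

Lemma factor_rcons u a : is_factor x (rcons u a) -> is_factor x u.
Proof. by rewrite -cats1; apply: factor_pre. Qed.

Lemma factor_cons u a : is_factor x (a :: u) -> is_factor x u.
Proof. by rewrite -cat1s; apply: factor_suf. Qed.

Lemma factor_extl w : is_factor x w -> exists a, is_factor x (a :: w).
Proof.
case=> i e; exists (x (i - 1)%R); exists (i - 1)%R.
by rewrite windowS subrK e.
Qed.

Lemma factor_extr w : is_factor x w -> exists b, is_factor x (rcons w b).
Proof.
case=> i e; exists (x (i + (size w)%:Z)%R); exists i.
by rewrite size_rcons windowSr e.
Qed.

Lemma factor_extrn n w : is_factor x w ->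
  exists2 v, size v = n & is_factor x (w ++ v).
Proof.
elim: n w => [|n IHn] w xw; first by exists [::] => //; rewrite cats0.
have [b /IHn[v sv xv]] := factor_extr xw.
by exists (b :: v); [rewrite /= sv | rewrite -cat_rcons].
Qed.

Lemma factor1 : word_over x -> forall a, is_factor x [:: a].
Proof. by move=> xA a; have [i <-] := xA a; exists i; rewrite windowS. Qed.

Lemma word_over_factor : (forall a, is_factor x [:: a]) -> word_over x.
Proof. by move=> xA a; have [i] := xA a; rewrite windowS => -[<-]; exists i. Qed.

End Factors.

Section Morphisms.
Variables (A B : finType) (s : seq A -> seq B).
Hypotheses (s_mor : is_morphism s) (s_ne : non_erasing s).

Lemma mor0 : s [::] = [::]. Proof. by case: s_mor. Qed.
Lemma mor_cat u v : s (u ++ v) = s u ++ s v. Proof. by case: s_mor. Qed.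
Lemma mor_cons a u : s (a :: u) = s [:: a] ++ s u.
Proof. by rewrite -cat1s mor_cat. Qed.
Lemma mor_rcons u a : s (rcons u a) = s u ++ s [:: a].
Proof. by rewrite -cats1 mor_cat. Qed.

Lemma mor_infix u v : infix u v -> infix (s u) (s v).
Proof.
case/infixP=> p [q ->]; rewrite !mor_cat; apply/infixP.
by eexists _, _; reflexivity.
Qed.

Lemma image_factor x y : is_image s x y -> forall w,
  is_factor y w <-> exists2 u, is_factor x u & infix w (s u).
Proof.
move=> xy.
(* As no letter is erased, the image of the centred window of radius [N] is a window of [y] covering
   at least the positions from [-N] to [N-1]. *)
have block N : exists L M, [/\ (N <= L)%N, (L + N <= M)%N &
    s (window x (- N%:Z)%R (N + N)) = window y (- L%:Z)%R M].
  have [eu ev] := xy N.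
  exists (size (s (window x (- N%:Z)%R N))).
  exists (size (s (window x (- N%:Z)%R N)) + size (s (window x 0%R N))); split.
  - by rewrite -[leqLHS](size_window x (- N%:Z)%R N); apply: leq_size_image.
  - by rewrite leq_add2l -[leqLHS](size_window x 0%R N); apply: leq_size_image.
  - by rewrite !window_cat !addNr mor_cat; congr (_ ++ _); [rewrite ev | rewrite eu].
move=> w; split=> [[i <-]|[u [i <-] wu]].
  have [L [M [NL LM e]]] := block (absz i + size w).
  exists (window x (- (absz i + size w)%:Z)%R ((absz i + size w) + (absz i + size w))).
    exact: window_factor.
  rewrite e; have -> : i = (- L%:Z + (absz (i + L%:Z)%R)%:Z)%R by lia.
  by apply: infix_window; lia.
have [L [M [NL LM e]]] := block (absz i + size u).
apply: (factor_infix wu).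
apply: (@factor_infix _ _ _ (s (window x (- (absz i + size u)%:Z)%R
    ((absz i + size u) + (absz i + size u))))).
  apply: mor_infix.
  have {1}-> : i = (- (absz i + size u)%:Z + (absz (i + (absz i + size u)%:Z)%R)%:Z)%R by lia.
  by apply: infix_window; lia.
by rewrite e; apply: window_factor.
Qed.

Lemma image_over x y : is_image s x y -> word_over x -> word_over y.
Proof.
move=> xy xA; apply: word_over_factor => b.
have [_ _ /(_ b)[a ba]] := s_mor.
apply/(image_factor xy); exists [:: a]; first exact: factor1.
by case/splitPr: ba => p q; apply/infixP; exists p, q.
Qed.

End Morphisms.

Lemma is_image_comp (A B C : finType) (t : seq A -> seq B) (s : seq B -> seq C) x y z :
  is_image t x y -> is_image s y z -> is_image (s \o t) x z.
Proof.
move=> xy yz n; have [xy1 xy2] := xy n; split => /=.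
  by have [+ _] := yz (size (t (window x 0%R n))); rewrite /= xy1.
by have [_] := yz (size (t (window x (- n%:Z)%R n))); rewrite /= xy2.
Qed.

Lemma is_morphism_comp (A B C : finType) (t : seq A -> seq B) (s : seq B -> seq C) :
  is_morphism t -> is_morphism s -> is_morphism (s \o t).
Proof.
move=> tM sM; split=> /= [|u v|c].
- by rewrite (mor0 tM) (mor0 sM).
- by rewrite (mor_cat tM) (mor_cat sM).
have [_ _ /(_ c)[b cb]] := sM; have [_ _ /(_ b)[a ba]] := tM.
exists a; case/splitPr: ba => p q.
by rewrite (mor_cat sM) (mor_cons sM) !mem_cat cb orbT.
Qed.

Lemma non_erasing_nil (A B : finType) (s : seq A -> seq B) :
  is_morphism s -> non_erasing s -> forall u, s u = [::] -> u = [::].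
Proof.
move=> sM sN u su; apply: size0nil; apply/eqP; rewrite -leqn0.
by apply: leq_trans (leq_size_image sM sN u) _; rewrite su.
Qed.

Lemma non_erasing_comp (A B C : finType) (t : seq A -> seq B) (s : seq B -> seq C) :
  is_morphism s -> non_erasing t -> non_erasing s -> non_erasing (s \o t).
Proof. by move=> sM tN sN a /= /(non_erasing_nil sM sN); apply: tN. Qed.

(** * Extension graphs of dendric words *)

Section Dendric.
Variable A : finType.
Implicit Types (x y : int -> A) (w : seq A) (a b : A).

(** Every factor extends on both sides, so the two-sided extensions determine the vertices as well
    as the edges, and the two graphs are literally equal. *)
Lemma ext_eq_tree (x y : int -> A) w v :
  (forall a b, is_factor x (a :: rcons w b) <-> is_factor y (a :: rcons v b)) ->
  is_tree (ext_vertices x w) (ext_edges x w) ->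
  is_tree (ext_vertices y v) (ext_edges y v).
Proof.
move=> e; suff [-> ->] : ext_vertices x w = ext_vertices y v /\ ext_edges x w = ext_edges y v by [].
have le a : is_factor x (a :: w) <-> is_factor y (a :: v).
  split=> /factor_extr[b]; first by rewrite rcons_cons => /e; rewrite -rcons_cons => /factor_rcons.
  by rewrite rcons_cons => /e; rewrite -rcons_cons => /factor_rcons.
have re b : is_factor x (rcons w b) <-> is_factor y (rcons v b).
  by split=> /factor_extl[a] /e /factor_cons.
split; first by apply/setP => -[a|b]; rewrite !inE; apply: asbool_equiv_eq.
by apply/funext => -[a|b]; apply/funext => -[a'|b'] //=; apply: asbool_equiv_eq.
Qed.

Lemma dendric_lang x y : (forall w, is_factor x w <-> is_factor y w) ->
  dendric x -> dendric y.
Proof.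
move=> xy xD w /xy /xD; apply: ext_eq_tree => a b; exact: xy.
Qed.

Lemma dendric_cycle4 x w a a' b b' : dendric x -> a <> a' -> b <> b' ->
  is_factor x (a :: rcons w b) -> is_factor x (a :: rcons w b') ->
  is_factor x (a' :: rcons w b) -> is_factor x (a' :: rcons w b') -> False.
Proof.
move=> xD aa bb f1 f2 f3 f4.
have xw : is_factor x w by move/factor_cons: f1; apply: factor_rcons.
have [_ _ /(_ [:: inl a; inr b; inl a'; inr b'] isT)] := xD _ xw; apply.
have va : is_factor x (a :: w) by apply: (@factor_rcons _ _ _ b); rewrite rcons_cons.
have va' : is_factor x (a' :: w) by apply: (@factor_rcons _ _ _ b); rewrite rcons_cons.
have vb := factor_cons f1; have vb' := factor_cons f2.
have na : inl a != inl a' :> A + A by apply/eqP => -[].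
have nb : inr b != inr b' :> A + A by apply/eqP => -[].
by rewrite /ucycle /= !inE !asboolT //= ?orbF na nb.
Qed.

End Dendric.

(** * Trees *)

(** Serves twice: for the reversal of words, which swaps the two sides of the graph, and for
    bijective codings, which rename the letters. *)
Lemma tree_iso (T T' : finType) (f : T -> T') (g : T' -> T) (V : {set T})
    (V' : {set T'}) (e : rel T) (e' : rel T') :
  cancel f g -> cancel g f -> (forall u, (f u \in V') = (u \in V)) ->
  (forall u v, e' (f u) (f v) = e u v) -> is_tree V e -> is_tree V' e'.
Proof.
move=> fK gK fV fe [/set0Pn[u0 u0V] co cy].
have fr : relpre f [rel u v in V' | e' u v] =2 [rel u v in V | e u v].
  by move=> u v; rewrite /= !fV fe.
split.
- by apply/set0Pn; exists (f u0); rewrite fV.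
- move=> u' v'; rewrite -[u']gK -[v']gK !fV => uV vV.
  have /connectP[p pp ->] := co _ _ uV vV.
  apply/connectP; exists (map f p); last by rewrite last_map.
  by rewrite path_map (eq_path fr).
move=> c sc /andP[cc uc]; apply: (cy (map g c)); first by rewrite size_map.
apply/andP; split; last by rewrite map_inj_uniq //; apply: can_inj gK.
by rewrite -(eq_cycle fr) -cycle_map -map_comp (eq_map gK) map_id.
Qed.

Section Broom.
Variables (A : finType) (x : int -> A) (w : seq A) (l : A).
Hypotheses (xl : is_factor x (l :: w))
  (hub : forall b, is_factor x (rcons w b) -> is_factor x (l :: rcons w b))
  (leaf : forall a b b', a != l -> is_factor x (a :: rcons w b) ->
     is_factor x (a :: rcons w b') -> b = b').

(** By [hub] every vertex is connected to the left vertex [l]. A vertex of a cycle has two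
    neighbours on it, so by [leaf] a cycle has no left vertex but [l]; yet a cycle of length greater
    than 2 in a bipartite graph has two left vertices. *)
Lemma broom_tree : is_tree (ext_vertices x w) (ext_edges x w).
Proof.
set V := ext_vertices x w; set e := ext_edges x w.
have sym : symmetric [rel u v in V | e u v].
  by move=> [a|b] [a'|b'] /=; rewrite ?andbF // [X in X && _ = _]andbC.
have lV : inl l \in V by rewrite inE; apply/asboolP.
have edge a b : is_factor x (a :: rcons w b) ->
    connect [rel u v in V | e u v] (inl a) (inr b).
  move=> f; apply: connect1; rewrite /= !inE !asboolT //.
    exact: factor_cons f.
  by apply: (@factor_rcons _ _ _ b); rewrite rcons_cons.
have tol u : u \in V -> connect [rel u v in V | e u v] (inl l) u.
  case: u => [a|b]; rewrite inE => /asboolP f; last exact/edge/hub.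
  have [b fb] := factor_extr f; rewrite rcons_cons in fb.
  apply: connect_trans (edge _ _ (hub (factor_cons fb))) _.
  by rewrite (sym_connect_sym sym); apply: edge.
split.
- by apply/set0Pn; exists (inl l).
- move=> u v uV vV; apply: connect_trans (tol _ vV).
  by rewrite (sym_connect_sym sym) tol.
have eVP u v : [rel u v in V | e u v] u v ->
    match u, v with
    | inl a, inr b | inr b, inl a => is_factor x (a :: rcons w b)
    | _, _ => False end.
  by move: u v => [a|b] [a'|b'] /= /andP[_] // /asboolP.
have left_l c : 2 < size c -> ucycle [rel u v in V | e u v] c ->
    forall a, inl a \in c -> a = l.
  move=> sc uc a ac; apply/eqP/negPn/negP => al.
  have [i c' rc] := rot_to ac.
  have sc' : 2 < size (rot i c) by rewrite size_rot.
  move: uc; rewrite -(rot_ucycle i) rc in sc' *.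
  case: c' sc' {rc} => // u c'; case: c' => [//|v c'] _ /andP[].
  rewrite (cycle_path (inl a)) => /andP[h1 /andP[h2 _]] /and3P[_ + _].
  have zc : last v c' \in v :: c' by apply: mem_last.
  move/eVP: h1; move/eVP: h2 => /=.
  case: u (last v c') zc => [//|b] [//|b'] zc f2 f1.
  by rewrite (leaf al f2 f1) zc.
move=> c sc uc; have lc := left_l c sc uc.
have cc := ucycle_cycle uc; have := ucycle_uniq uc.
case: c sc cc lc {uc} => [//|u [//|v [//|z c]]] _ /= /andP[/eVP uv /andP[/eVP vz zc]] lc.
case: u v z uv vz zc lc => [a|b] [a'|b'] [a''|b''] // _ _ zc lc.
  by rewrite (lc a) ?inE ?eqxx // (lc a'') ?inE ?eqxx ?orbT.
case: c zc lc => [|t c]; first by move=> /andP[/eVP].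
move=> /= /andP[/eVP + _]; case: t => [t|//] _ lc.
rewrite (lc a') ?inE ?eqxx ?orbT // (lc t) ?inE ?eqxx ?orbT //.
by rewrite /= andbF.
Qed.

End Broom.

Lemma dendric_connect (A : finType) (x : int -> A) w (P : A + A -> Prop) u v :
  dendric x -> is_factor x w -> u \in ext_vertices x w -> v \in ext_vertices x w ->
  (forall a b, is_factor x (a :: rcons w b) -> P (inl a) <-> P (inr b)) ->
  P u -> P v.
Proof.
move=> xD xw uV vV eP; have [_ co _] := xD w xw.
have /connectP[p + ->] := co _ _ uV vV.
elim: p u {uV} => //= u p IHp u' /andP[+ pp] Pu'; case/andP=> _ uu'.
apply: IHp pp _; move: u' u Pu' uu' => [a|b] [a'|b'] //= Pu /asboolP f.
  exact/(eP _ _ f).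
exact/(eP _ _ f).
Qed.

(* Connectedness of the extension graphs lets a bounded window that determines
   the state S i shrink by one letter at a time, down to the empty window. *)
Lemma dendric_state_const (A : finType) (x : int -> A) (X : Type)
    (S : int -> X) (h : X -> A -> X) m :
  dendric x -> (forall i, S (i + 1)%R = h (S i) (x i)) ->
  (forall i j, window x i m = window x j m -> S i = S j) ->
  forall i j, S i = S j.
Proof.
move=> xD hS; elim: m => [|m IHm] det i j; first exact: det.
apply: IHm => {i j} i j eij.
pose w := window x i m.
(* A vertex has the property [P] when, in all occurrences of its extension of [w], the state at the
   start of [w] is [S i]. In an occurrence of [a w b] this state is determined by [w b] directly and
   by [a w] through one update [h], so the two ends of an edge agree. *)
pose P (u : A + A) := match u with
  | inl a => forall k, window x k m.+1 = a :: w -> S (k + 1)%R = S i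
  | inr b => forall k, window x k m.+1 = rcons w b -> S k = S i end.
have xw : is_factor x w by apply: window_factor.
have P1 : P (inr (x (i + m%:Z)%R)).
  by move=> k /= wk; apply: det; rewrite wk windowSr.
have P2 : P (inr (x (j + m%:Z)%R)).
  apply: dendric_connect xD xw _ _ _ P1; last 1 first.
  - move=> a b [k]; rewrite /= size_rcons size_window windowS => -[xk wk]; split=> /= H.
      move=> k' wk'; rewrite -(H k); first by apply: det; rewrite wk wk'.
      by move: wk; rewrite windowSr => /rcons_inj[wk _]; rewrite windowS xk wk.
    move=> k' wk'; rewrite -(H _ wk) !hS xk.
    move: wk'; rewrite windowS => -[xk' wk']; rewrite xk'; congr h; apply: det.
    move: wk; rewrite windowSr => /rcons_inj[wk _].
    by rewrite !windowS wk' xk' xk wk.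
  - by rewrite inE; apply/asboolP; rewrite /w -windowSr; apply: window_factor.
  - by rewrite inE; apply/asboolP; rewrite /w eij -windowSr; apply: window_factor.
by rewrite (P2 j) // windowSr /w eij.
Qed.

(** * Marked morphisms *)

Lemma cat_eq_cat (T : Type) (u1 u2 v1 v2 : seq T) : u1 ++ u2 = v1 ++ v2 ->
  (exists2 w, v1 = u1 ++ w & u2 = w ++ v2) \/
  (exists b w, u1 = v1 ++ b :: w /\ v2 = b :: w ++ u2).
Proof.
elim: u1 v1 => [|a u1 IH] [|b v1] /=; first by move=> ->; left; exists [::].
- by move=> ->; left; exists (b :: v1).
- by move=> <-; right; exists a, u1.
case=> -> /IH[[w -> ->]|[c [w [-> ->]]]]; first by left; exists w.
by right; exists c, w.
Qed.

Lemma first_occurrence (T : eqType) (a : T) w : a \in w ->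
  exists r s, w = r ++ a :: s /\ a \notin r.
Proof.
elim: w => // b w IHw; rewrite inE; case: eqVneq => [-> _|ab /= /IHw[r [s [-> ar]]]].
  by exists [::], w.
by exists (b :: r), s; rewrite inE negb_or ab.
Qed.

Lemma extend_cat (A B : finType) (f : A -> seq B) u v :
  extend f (u ++ v) = extend f u ++ extend f v.
Proof. by rewrite /extend map_cat flatten_cat. Qed.

Lemma extend1 (A B : finType) (f : A -> seq B) a : extend f [:: a] = f a.
Proof. by rewrite /extend /= cats0. Qed.

Lemma extend_morphism (A B : finType) (f : A -> seq B) :
  (forall b, exists a, b \in f a) -> is_morphism (extend f).
Proof.
move=> fB; split=> // [u v|b]; first exact: extend_cat.
by have [a ba] := fB b; exists a; rewrite extend1.
Qed.

(** The edges are exactly the pairs of a left and a right vertex that involve one of the two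
    centres. This is stronger than being a tree, and it is the hypothesis under which
    [marker_dendric] makes an image dendric. *)
Definition double_star (A : finType) (x : int -> A) (w : seq A) : Prop :=
  exists l0 r0, [/\ is_factor x (l0 :: w), is_factor x (rcons w r0) &
    forall a b, is_factor x (a :: rcons w b) <->
      [/\ is_factor x (a :: w), is_factor x (rcons w b) & a = l0 \/ b = r0]].

Lemma double_star_tree (A : finType) (x : int -> A) w : double_star x w ->
  is_tree (ext_vertices x w) (ext_edges x w).
Proof.
case=> l0 [r0 [xl xr xE]]; apply: (@broom_tree _ _ _ l0) => // [b xb|a b b' al].
  by apply/xE; split=> //; left.
by move=> /xE[_ _ [/eqP|->]]; rewrite ?(negPf al) // => /xE[_ _ [/eqP|->]];
   rewrite ?(negPf al).
Qed.

Section Marker.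
Variables (A : finType) (d : A) (t : A -> seq A).
Hypotheses (td : forall z, d \notin t z) (t_inj : injective (fun z => head d (t z))).
Local Notation H := (extend (fun z => d :: t z)).

Lemma marker_head u : head d (H u) = d.
Proof. by case: u. Qed.

(** As [d] occurs only at the start of the image of a letter, each occurrence of [d] opens a block.
    The letter after it is [head d (t z)]: when [t z] is empty, it is the [d] of the next block. *)
Lemma marker_cut u p r : H u = p ++ d :: r ->
  exists u1 u2, [/\ u = u1 ++ u2, H u1 = p & H u2 = d :: r].
Proof.
elim: u p => [|z u IHu] p; first by case: p.
case: p => [|e p] Hu; first by exists [::], (z :: u).
case: Hu; rewrite -/(H u) => <- /cat_eq_cat[[w -> /IHu[u1 [u2 [-> <- Hu2]]]]|].
  by exists (z :: u1), u2.
case=> b [w [tz [db _]]]; have := td z.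
by rewrite tz mem_cat db inE eqxx orbT.
Qed.

Lemma head_marker z u b q : t z ++ H u = b :: q -> head d (t z) = b.
Proof.
case: (t z) => [|c s] /=; last by case.
by move=> e; have := marker_head u; rewrite e /= => ->.
Qed.

Lemma marker_inj : injective H.
Proof.
have hd z u : head d (t z ++ H u) = head d (t z).
  by case: (t z) => //=; rewrite marker_head.
elim=> [|z u IHu] [|z' v] //= [] /[dup] /(congr1 (head d)).
rewrite -/(H u) -/(H v) !hd => /t_inj -> /eqP.
by rewrite eqseq_cat // eqxx => /eqP /IHu ->.
Qed.

Lemma marker_cut2 u v p r : H u = p ++ H v ++ d :: r ->
  exists u1 u2, [/\ u = u1 ++ v ++ u2, H u1 = p & H u2 = d :: r].
Proof.
move=> Hu; have [s es] : exists s, H v ++ d :: r = d :: s.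
  by case: v {Hu} => [|z v]; eexists; reflexivity.
have [u1 [u2 [-> <- Hu2]]] := marker_cut (etrans Hu (congr1 (cat p) es)).
have [u3 [u4 [-> /marker_inj -> Hu4]]] := marker_cut (etrans Hu2 (esym es)).
by exists u1, u4.
Qed.

Hypothesis H_mor : is_morphism H.
Variables (x y : int -> A).
Hypothesis xy : is_image H x y.

Lemma marker_ne : non_erasing H. Proof. by move=> z; rewrite extend1. Qed.

Let imf := image_factor H_mor marker_ne xy.

Lemma marker_decode r v e b : d \notin r ->
  is_factor y (e :: rcons (r ++ rcons (H v) d) b) <->
  exists z z', [/\ suffix (e :: r) (d :: t z), head d (t z') = b &
                   is_factor x (z :: rcons v z')].
Proof.
move=> dr.
have E : e :: rcons (r ++ rcons (H v) d) b = (e :: r) ++ H v ++ [:: d; b].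
  by rewrite rcons_cat -cats1 -cats1 -catA.
rewrite E; split=> [/imf[u xu /infixP[p [q Hu]]]|[z [z' [/suffixP[p ez] <- xv]]]].
  have {}Hu : H u = (p ++ e :: r) ++ H v ++ d :: b :: q by rewrite Hu -?catA /= -?catA.
  have [u1 [u2 [eu Hu1 Hu2]]] := marker_cut2 Hu.
  case: u2 eu Hu2 => // z' u2 eu [/head_marker Hz'].
  case/lastP: u1 eu Hu1 => [|u1 z] eu Hu1; first by case: p Hu1 {Hu}.
  exists z, z'; split=> //.
    move: Hu1; rewrite -cats1 extend_cat extend1 => /cat_eq_cat[[s _ ->]|].
      exact: suffix_suffix.
    case=> c [s [_ [_ er]]]; rewrite er mem_cat inE eqxx orbT in dr.
    by [].
  apply: factor_infix xu; apply/infixP; exists u1, u2.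
  by rewrite eu cat_rcons /= cat_rcons.
(* The extra letter [z2] supplies one more [d], which is the letter after the marker when [t z'] is
   empty. *)
have [z2 xz2] := factor_extr xv.
apply/imf; exists (z :: rcons (rcons v z') z2) => //.
have -> : z :: rcons (rcons v z') z2 = [:: z] ++ v ++ [:: z'] ++ [:: z2].
  by rewrite -!cats1 -!catA.
rewrite !extend_cat !extend1 ez.
apply/infixP; case: (t z') => [|c s] /=.
  by exists p, (t z2); rewrite -!catA.
by exists p, (s ++ d :: t z2); rewrite -!catA.
Qed.

Lemma marker_parse w : is_factor y (rcons w d) ->
  exists r v, [/\ d \notin r, rcons w d = r ++ rcons (H v) d & is_factor x v].
Proof.
move=> /imf[u xu /infixP[p [q Hu]]].
have dw : d \in rcons w d by rewrite mem_rcons inE eqxx.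
move: Hu; set w' := rcons w d in dw *.
have [r [s [ew dr]]] : exists r s, w' = r ++ d :: s /\ d \notin r.
  exact: first_occurrence.
have [s' es] : exists s', d :: s = rcons s' d.
  case/lastP: s ew => [|s c]; first by exists [::].
  rewrite -rcons_cons -rcons_cat => /rcons_inj[_ <-].
  by exists (d :: s).
rewrite ew -catA /= catA => Hu.
have [u1 [u2 [eu _ Hu2]]] := marker_cut Hu.
rewrite -cat_cons es cat_rcons in Hu2.
have [v [u4 [eu2 Hv _]]] := marker_cut Hu2.
exists r, v; split=> //; first by rewrite Hv es.
by apply: factor_infix xu; rewrite eu eu2; apply: infix_infix.
Qed.

(* A left letter of the decoded word survives in y as at most one letter, so
   the centre of a double star, if it survives, stays a centre. *)
Lemma marker_dendric (nxt : A -> A) :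
  (forall e b, e != d -> is_factor y [:: e; b] -> b = nxt e) ->
  word_over x -> (forall v, is_factor x v -> double_star x v) -> dendric y.
Proof.
move=> nxtP xA xD w; case/lastP: w => [|w e] yw.
  have yd : is_factor y [:: d].
    have [a _] := factor_extr yw; have /factor_extr[c xc] := factor1 xA a.
    apply/imf; exists [:: a; c] => //.
    by apply/infixP; exists [::]; eexists; reflexivity.
  apply: (@broom_tree _ _ _ d) => //= [b _|a b b' ad /(nxtP _ _ ad)-> /(nxtP _ _ ad)//].
  have [g _ gK] := injF_bij t_inj.
  have [c xc] := factor_extr (factor1 xA (g b)).
  apply/imf; exists [:: g b; c] => //; apply/infixP; rewrite /extend /=.
  by case: (t (g b)) (gK b) => [|c' s] /= <-; exists [::]; eexists; reflexivity.
have [ed|ed] := eqVneq e d; last first.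
  have uni b : is_factor y (rcons (rcons w e) b) -> b = nxt e.
    rewrite -!cats1 -catA => /factor_suf; exact: nxtP.
  have [l0 yl] := factor_extl yw.
  have uni' a b : is_factor y (a :: rcons (rcons w e) b) -> b = nxt e.
    by move/factor_cons; apply: uni.
  apply: (@broom_tree _ _ _ l0) => // [b /uni ->|a b b' _ /uni' -> /uni' -> //].
  by have [b0] := factor_extr yl; rewrite rcons_cons => /[dup] /uni' ->.
rewrite {e}ed in yw *.
have [r [v [dr ew xv]]] := marker_parse yw.
have dec e b : is_factor y (e :: rcons (rcons w d) b) <->
    exists z z', [/\ suffix (e :: r) (d :: t z), head d (t z') = b &
                     is_factor x (z :: rcons v z')].
  by rewrite ew; apply: marker_decode.
have sufU z e e' : suffix (e :: r) (d :: t z) -> suffix (e' :: r) (d :: t z) -> e = e'.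
  move=> /suffixP[p ep] /suffixP[p']; rewrite ep => epp.
  have /eqP := epp; rewrite -!cat_rcons eqseq_cat.
    by case/andP=> /eqP /rcons_inj[].
  by have := congr1 size epp; rewrite !size_cat !size_rcons /= => /eqP; rewrite eqn_add2r => /eqP ->.
have [l0 [r0 [xl xr xE]]] := xD v xv.
(* If the left centre [l0] survives as a letter [e0], that letter is the hub and the other left
   letters see only the image of [r0]. If it does not survive, the image of [r0] is the only right
   vertex. *)
have [[e0 l0e0]|no] := pselect (exists e0, suffix (e0 :: r) (d :: t l0)).
  have [z' xz'] := factor_extr xl; rewrite rcons_cons in xz'.
  apply: (@broom_tree _ _ _ e0).
  - apply: (@factor_rcons _ _ _ (head d (t z'))); rewrite rcons_cons.
    by apply/dec; exists l0, z'.
  - move=> b /factor_extl[e /dec[z [z2 [_ <- xz]]]].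
    apply/dec; exists l0, z2; split=> //; apply/xE; split=> //; last by left.
    exact: factor_cons xz.
  move=> a b b' ae /dec[z [z2 [s1 <- /xE[_ _ z2r]]]] /dec[z3 [z4 [s2 <- /xE[_ _ z4r]]]].
  have nl z0 : suffix (a :: r) (d :: t z0) -> z0 <> l0.
    by move=> s ez; move: ae; rewrite (sufU z0 a e0) ?eqxx // ez.
  by case: z2r z4r => [/(nl _ s1)//|->] [/(nl _ s2)//|->].
have br e b : is_factor y (e :: rcons (rcons w d) b) -> b = head d (t r0).
  case/dec=> z [z2 [s <- /xE[_ _ [ez|->]//]]].
  by case: no; exists e; rewrite -ez.
have [l1 yl] := factor_extl yw.
apply: (@broom_tree _ _ _ l1) => // [b /factor_extl[e /br ->]|a b b' _ /br -> /br -> //].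
by have [b0] := factor_extr yl; rewrite rcons_cons => /[dup] /br ->.
Qed.

End Marker.

(** * Arnoux-Rauzy morphisms *)

Section ARmorphisms.
Variables (A : finType) (l : A).
Implicit Types (x y : int -> A) (w u v : seq A) (a b : A).

Lemma AR_L_morphism : is_morphism (AR_L l).
Proof.
by apply: extend_morphism => a; exists a; case: eqVneq => [->|_]; rewrite !inE eqxx ?orbT.
Qed.

Lemma AR_R_morphism : is_morphism (AR_R l).
Proof.
by apply: extend_morphism => a; exists a; case: eqVneq => [->|_]; rewrite !inE eqxx ?orbT.
Qed.

Lemma AR_L_ne : non_erasing (AR_L l).
Proof. by move=> a; rewrite /AR_L extend1; case: eqP. Qed.

Lemma AR_R_ne : non_erasing (AR_R l).
Proof. by move=> a; rewrite /AR_R extend1; case: eqP. Qed.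

Lemma AR_R_conj u : l :: AR_R l u = rcons (AR_L l u) l.
Proof.
elim: u => //= a u IHu; rewrite /AR_R /AR_L /extend /= -/(AR_R l u) -/(AR_L l u).
by case: eqP => _ /=; rewrite IHu.
Qed.

Let t a := if a == l then [::] else [:: a].

Lemma AR_L_marker : AR_L l = extend (fun z => l :: t z).
Proof.
apply/funext => u; congr flatten; apply: eq_map => a.
by rewrite /t; case: eqP.
Qed.

Let tl z : l \notin t z.
Proof. by rewrite /t; case: (eqVneq z l) => // zl; rewrite inE eq_sym. Qed.

Let headt z : head l (t z) = z.
Proof. by rewrite /t; case: (eqVneq z l) => // ->. Qed.

Let t_inj : injective (fun z => head l (t z)).
Proof. by move=> z z'; rewrite !headt. Qed.

Let suft z e : suffix [:: e] (l :: t z) = (e == z).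
Proof.
by rewrite /t; case: (eqVneq z l) => [->|_]; rewrite suffixE /= ?eqseq_cons ?andbT // eq_sym.
Qed.

Lemma AR_L_pair u a b : infix [:: a; b] (AR_L l u) -> a = l \/ b = l.
Proof.
pose r a b := (a == l) || (b == l).
have pl : path r l (AR_L l u).
  elim: u => // a' u IHu; rewrite -cat1s /AR_L extend_cat extend1 -/(AR_L l u).
  have := marker_head l t u; rewrite -AR_L_marker.
  by case: eqP => _; case: (AR_L l u) IHu => //= [|c s /[swap] ->]; rewrite /r !eqxx ?orbT.
have so : sorted r (AR_L l u) by apply: path_sorted pl.
move=> /infix_sorted /(_ so) /=; rewrite andbT.
by case/orP => /eqP; [left|right].
Qed.

Section Image.
Variables x y : int -> A.
Hypothesis xy : is_image (AR_L l) x y.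

Let H_mor : is_morphism (extend (fun z => l :: t z)).
Proof. by rewrite -AR_L_marker; apply: AR_L_morphism. Qed.
Let xyH : is_image (extend (fun z => l :: t z)) x y.
Proof. by rewrite -AR_L_marker. Qed.

Lemma AR_L_decode v a b :
  is_factor x (a :: rcons v b) <-> is_factor y (a :: rcons (rcons (AR_L l v) l) b).
Proof.
have := marker_decode tl t_inj H_mor xyH (r := [::]) v a b isT.
rewrite cat0s -AR_L_marker => ->; split=> [xv|[z [z' []]]].
  by exists a, b; rewrite suft headt.
by rewrite suft headt => /eqP -> <-.
Qed.

Lemma AR_L_pred e w : e != l -> forall a, is_factor y (a :: e :: w) -> a = l.
Proof.
move=> el a; rewrite -[_ :: _ :: _]/([:: a; e] ++ w) => /factor_pre.
case/(image_factor AR_L_morphism AR_L_ne xy) => u _ /AR_L_pair[//|ee].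
by rewrite ee eqxx in el.
Qed.

Lemma AR_L_succ e w : e != l -> forall b, is_factor y (rcons (rcons w e) b) -> b = l.
Proof.
move=> el b; rewrite -!cats1 -catA => /factor_suf.
case/(image_factor AR_L_morphism AR_L_ne xy) => u _ /AR_L_pair[ee|//].
by rewrite ee eqxx in el.
Qed.

Hypothesis xA : word_over x.

Lemma AR_L_pairs a b : is_factor y [:: a; b] <-> a = l \/ b = l.
Proof.
split.
  by case/(image_factor AR_L_morphism AR_L_ne xy) => u _; apply: AR_L_pair.
suff [pl pr] : is_factor y [:: a; l] /\ is_factor y [:: l; b].
  by case=> ->.
split.
  have [c xc] := factor_extr (factor1 xA a).
  apply/(image_factor AR_L_morphism AR_L_ne xy); exists [:: a; c] => //.
  apply/infixP; rewrite AR_L_marker /extend /= /t.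
  case: (eqVneq a l) => [->|_]; first by exists [::]; eexists; reflexivity.
  by exists [:: l]; eexists; reflexivity.
have [c xc] := factor_extr (factor1 xA b).
apply/(image_factor AR_L_morphism AR_L_ne xy); exists [:: b; c] => //.
apply/infixP; rewrite AR_L_marker /extend /= /t.
by case: (eqVneq b l) => [->|_]; exists [::]; eexists; reflexivity.
Qed.

(** The empty word has the centre [l] on both sides. A last letter other than [l] forces the right
    extension to be [l], a first letter other than [l] forces the left one. The remaining words are
    [AR_L l v] followed by [l], and they decode to [v]. *)
Lemma AR_L_ext w : is_factor y w -> double_star y w \/
  exists v, [/\ size v < size w, is_factor x v &
    forall a b, is_factor x (a :: rcons v b) <-> is_factor y (a :: rcons w b)].
Proof.
case/lastP: w => [|w e] yw.
  have yA := image_over AR_L_morphism AR_L_ne xy xA.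
  left; exists l, l; split; try exact: factor1.
  move=> a b; split; last by case=> _ _ /AR_L_pairs.
  by move/AR_L_pairs; split=> //; exact: factor1.
have [ee|el] := eqVneq e l; last first.
  left; have [a0 ya0] := factor_extl yw; have [b0 yb0] := factor_extr yw.
  exists a0, l; split=> //; first by rewrite -(AR_L_succ el yb0).
  have su a b : is_factor y (a :: rcons (rcons w e) b) -> b = l.
    by move/factor_cons; apply: AR_L_succ.
  move=> a b; split=> [yab|[yl /(AR_L_succ el) -> _]].
    split; [|exact: factor_cons yab|by right; exact: su yab].
    by apply: (@factor_rcons _ _ _ b); rewrite rcons_cons.
  by have [c] := factor_extr yl; rewrite rcons_cons => /[dup] /su ->.
subst e.
have [r [v [lr ew xv]]] := marker_parse tl H_mor xyH yw.
rewrite -AR_L_marker in ew.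
case: r lr ew => [|e r] lr ew.
  right; exists v; split=> //; last by move=> a b; rewrite ew; apply: AR_L_decode.
  by rewrite ew size_rcons ltnS leq_size_image //; [apply: AR_L_morphism|apply: AR_L_ne].
left; have el : e != l by rewrite inE negb_or eq_sym in lr; case/andP: lr.
have [a0 ya0] := factor_extl yw; have [b0 yb0] := factor_extr yw.
have pr a s : is_factor y (a :: (rcons w l ++ s)) -> a = l.
  by rewrite ew; apply: AR_L_pred.
have pr0 a : is_factor y (a :: rcons w l) -> a = l.
  by have := pr a [::]; rewrite cats0.
have pr1 a b : is_factor y (a :: rcons (rcons w l) b) -> a = l.
  by rewrite -cats1; apply: pr.
exists l, b0; split=> //; first by have := ya0; rewrite (pr0 _ ya0).
move=> a b; split=> [yab|[/pr0 -> /factor_extl[c yc] _]]; last first.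
  by have := yc; rewrite (pr1 _ _ yc).
split; [|exact: factor_cons yab|by left; exact: pr1 yab].
by apply: (@factor_rcons _ _ _ b); rewrite rcons_cons.
Qed.

Lemma AR_L_dendric : dendric x -> dendric y.
Proof.
move=> xD w /AR_L_ext[/double_star_tree//|[v [_ xv e]]].
exact: ext_eq_tree e (xD v xv).
Qed.

End Image.

(** Each extension graph of [x] is, by decoding, an extension graph of [y]. *)
Lemma AR_L_dendric_inv x y : is_image (AR_L l) x y -> dendric y -> dendric x.
Proof.
move=> xy yD v xv; apply: (@ext_eq_tree _ y x (rcons (AR_L l v) l)).
  by move=> a b; split=> /(AR_L_decode xy).
apply: yD; have [a /factor_extr[b]] := factor_extl xv.
by rewrite rcons_cons => /(AR_L_decode xy) /factor_cons /factor_rcons.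
Qed.

(** The two morphisms are conjugate by the letter [l], so a factor of one image of [u] is found in
    the other image of [u] lengthened by one letter. *)
Lemma AR_R_factor x y z : is_image (AR_L l) x y -> is_image (AR_R l) x z ->
  forall w, is_factor y w <-> is_factor z w.
Proof.
move=> xy xz w; rewrite (image_factor AR_L_morphism AR_L_ne xy).
rewrite (image_factor AR_R_morphism AR_R_ne xz); split.
  case=> u xu wu; have [a xa] := factor_extl xu.
  exists (a :: u) => //; rewrite (mor_cons AR_R_morphism).
  have [p ->] : exists p, AR_R l [:: a] = rcons p l.
    rewrite /AR_R extend1; case: eqP => _; last by exists [:: a].
    by exists [::].
  rewrite cat_rcons AR_R_conj; apply/infix_catl/(infix_trans wu).
  exact: infix_rcons.
case=> u xu wu; have [b xb] := factor_extr xu.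
exists (rcons u b) => //; rewrite (mor_rcons AR_L_morphism).
have [q ->] : exists q, AR_L l [:: b] = l :: q.
  rewrite /AR_L extend1; case: eqP => _; last by exists [:: b].
  by exists [::].
rewrite -cat_rcons -AR_R_conj; apply/infix_catr/(infix_trans wu).
exact: infix_cons.
Qed.

End ARmorphisms.

(** * Uniformly recurrent Arnoux-Rauzy words *)

Section FixedPoint.
Variables (A : finType) (tau : seq A -> seq A) (a : A) (p q : seq A).
Hypotheses (tauM : is_morphism tau) (tauN : non_erasing tau).
Hypotheses (tau_p : tau [:: a] = a :: p) (tau_q : tau [:: a] = rcons q a) (p0 : p <> [::]).

Let agree (x y : int -> A) n := forall i : int, (- n%:Z <= i < n%:Z)%R -> x i = y i.

Let agree_window x y n i m : agree x y n -> (- n%:Z <= i)%R -> (i + m%:Z <= n%:Z)%R ->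
  window x i m = window y i m.
Proof.
move=> xy ni im; apply/eq_in_map => k; rewrite mem_iota => km; apply: xy; lia.
Qed.

Let window_eq (x y : int -> A) i m (j : int) : window x i m = window y i m ->
  (i <= j < i + m%:Z)%R -> x j = y j.
Proof.
move=> e ij; have km : absz (j - i)%R < m by lia.
have -> : j = (i + (absz (j - i)%R)%:Z)%R by lia.
by have := congr1 (fun w => nth a w (absz (j - i)%R)) e; rewrite !nth_mkseq.
Qed.

Let next (x : int -> A) := projT1 (cid (is_image_exists tauM tauN x)).
Let nextP x : is_image tau x (next x).
Proof. exact: projT2 (cid (is_image_exists tauM tauN x)). Qed.

Let X k := iter k next (fun=> a).

Let X0 k : X k 0%R = a /\ X k (-1)%R = a.
Proof.
elim: k => [|k [IH1 IH2]] //=; have [/= e1 e2] := nextP (X k) 1%N.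
have w1 : window (X k) 0%R 1 = [:: a] by rewrite windowS IH1.
have w2 : window (X k) (- 1%:Z)%R 1 = [:: a] by rewrite windowS IH2.
rewrite w1 tau_p windowS in e1; rewrite w2 tau_q size_rcons windowSr in e2.
split; first by case: e1.
have [_ <-] := rcons_inj e2; congr next; lia.
Qed.

Let size_tau w : a \in w -> size w < size (tau w).
Proof.
case/splitPr=> u v; rewrite (mor_cat tauM) (mor_cons tauM) !size_cat tau_p /=.
have := leq_size_image tauM tauN u; have := leq_size_image tauM tauN v.
case: p p0 => //= b p' _; lia.
Qed.

(** The letters [a] on both sides of the origin have images longer than one letter, so the radius of
    agreement grows. *)
Let agree_next x y n : agree x y n.+1 -> x 0%R = a -> x (-1)%R = a ->
  agree (next x) (next y) n.+2.
Proof.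
move=> xy x0 x1 i ni.
have [/= ex1 ex2] := nextP x n.+1; have [/= ey1 ey2] := nextP y n.+1.
have [i0|i0] := boolP (0 <= i)%R.
  have sz : n.+1 < size (tau (window x 0%R n.+1)).
    rewrite -[X in X < _](size_window x 0%R) size_tau //.
    by rewrite windowS x0 inE eqxx.
  rewrite -(agree_window (n := n.+1) xy) in ey1; [|lia..].
  by apply: (window_eq (etrans ex1 (esym ey1))); lia.
have sz : n.+1 < size (tau (window x (- n.+1%:Z)%R n.+1)).
  rewrite -[X in X < _](size_window x (- n.+1%:Z)%R) size_tau //.
  rewrite windowSr mem_rcons; have -> : (- n.+1%:Z + n%:Z)%R = (-1)%R by lia.
  by rewrite x1 inE eqxx.
rewrite -(agree_window (n := n.+1) xy) in ey2; [|lia..].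
by apply: (window_eq (etrans ex2 (esym ey2))); lia.
Qed.

Let agree_X k : agree (X k) (X k.+1) k.+1.
Proof.
elim: k => [|k IHk]; last by apply: agree_next IHk _ _; have [] := X0 k.
move=> i i1; have [-> | ->] : i = 0%R \/ i = (-1)%R by lia.
  by rewrite (proj1 (X0 1)).
by rewrite (proj2 (X0 1)).
Qed.

(** The iterates [X k] of the constant word [a] stabilise on growing windows around the origin; the
    diagonal [X (absz i) i] is their limit. *)
Lemma fixed_point : exists x : int -> A,
  [/\ is_image tau x x, x 0%R = a & x (-1)%R = a].
Proof.
pose x (i : int) := X (absz i) i.
have xX k : agree x (X k) k.
  have le m n i : m <= n -> (- m.+1%:Z <= i < m.+1%:Z)%R -> X n i = X m i.
    move=> /subnK <-; elim: (n - m) => // r IHr im.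
    rewrite addSn -(@agree_X (r + m)) ?IHr //; lia.
  by move=> i ik; rewrite /x; apply/esym/le; lia.
exists x; split; [|exact: (proj1 (X0 0))|exact: (proj2 (X0 1))].
move=> n; set u := tau _; set v := tau _ => /=.
pose m := n + size u + size v.
have [/= e1 e2] := nextP (X m) n.
rewrite -(agree_window (xX m)) in e1; [|lia..]; rewrite -/u in e1.
rewrite -(agree_window (xX m)) in e2; [|lia..]; rewrite -/v in e2.
by split; rewrite (agree_window (xX m.+1)) //; lia.
Qed.

End FixedPoint.

Section BaseWord.
Variable A : finType.
Implicit Types (l a b c : A) (s u v w : seq A).

(** The head of the list is the outermost morphism, so decoding consumes the list from its head. *)
Definition AR_Ls (s : seq A) : seq A -> seq A :=
  foldr (fun l f => AR_L l \o f) (fun w => w) s.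

Lemma id_morphism : is_morphism (fun w : seq A => w).
Proof. by split=> // a; exists a; rewrite inE. Qed.

Lemma AR_Ls_morphism s : is_morphism (AR_Ls s).
Proof.
elim: s => [|l s IHs] /=; first exact: id_morphism.
exact: is_morphism_comp IHs (AR_L_morphism l).
Qed.

Lemma AR_Ls_ne s : non_erasing (AR_Ls s).
Proof.
elim: s => [|l s IHs] //=.
by apply: non_erasing_comp IHs (AR_L_ne (l := l)); apply: AR_L_morphism.
Qed.

Lemma AR_Ls_last s b : exists q, AR_Ls s [:: b] = rcons q b.
Proof.
elim: s => [|l s [q IHs]] /=; first by exists [::].
rewrite IHs (mor_rcons (AR_L_morphism l)) /AR_L extend1.
case: eqP => [->|_]; first by exists (AR_L l q); rewrite cats1.
by exists (AR_L l q ++ [:: l]); rewrite rcons_cat.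
Qed.

Lemma AR_L_head l u : u <> [::] -> exists p, AR_L l u = l :: p.
Proof.
case: u => // a u _; rewrite /AR_L /extend /=; case: eqP => _; eexists; reflexivity.
Qed.

Lemma AR_Ls_head l s b : exists p, AR_Ls (l :: s) [:: b] = l :: p.
Proof. by apply: AR_L_head; apply: AR_Ls_ne. Qed.

Lemma AR_Ls_mem l s b : l \in s -> l \in AR_Ls s [:: b].
Proof.
elim: s => // c s IHs; rewrite inE; case: eqVneq => [->|_ /= /IHs].
  by have [p ->] := AR_Ls_head c s b; rewrite inE eqxx.
case/splitPr=> u v; rewrite (mor_cat (AR_L_morphism c)) mem_cat.
rewrite (mor_cons (AR_L_morphism c)) mem_cat.
rewrite {2}/AR_L extend1; case: eqP => [->|_]; rewrite !inE eqxx ?orbT //.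
Qed.

Lemma double_star_ext (x y : int -> A) v w :
  (forall a b, is_factor x (a :: rcons v b) <-> is_factor y (a :: rcons w b)) ->
  double_star x v -> double_star y w.
Proof.
move=> e.
have le a : is_factor x (a :: v) <-> is_factor y (a :: w).
  split=> /factor_extr[b]; first by rewrite rcons_cons => /e; rewrite -rcons_cons => /factor_rcons.
  by rewrite rcons_cons => /e; rewrite -rcons_cons => /factor_rcons.
have re b : is_factor x (rcons v b) <-> is_factor y (rcons w b).
  by split=> /factor_extl[a] /e /factor_cons.
case=> l0 [r0 [/le yl /re yr xE]]; exists l0, r0; split=> // a b.
rewrite -e; split=> [/xE[/le yl2 /re yr2 ab]|[/le yl2 /re yr2 ab]] //; exact/xE.
Qed.

Lemma is_image_id (x : int -> A) : is_image (fun w => w) x x.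
Proof. by move=> n; rewrite /= !size_window. Qed.

(** The word is a fixed point of the product of all [AR_L l]. The last property is uniform
    recurrence in the form used later: [x] is a concatenation of blocks [rho [:: b]], each of which
    contains [u]. *)
Theorem base_word : 1 < #|A| -> exists x : int -> A,
  [/\ word_over x, forall w, is_factor x w -> double_star x w &
      forall u, is_factor x u -> exists rho : seq A -> seq A,
        [/\ is_morphism rho, non_erasing rho, is_image rho x x &
            forall b, infix u (rho [:: b])]].
Proof.
move=> cA; pose tau := AR_Ls (enum A).
have tM : is_morphism tau := AR_Ls_morphism (enum A).
have tN : non_erasing tau := AR_Ls_ne (s := enum A).
have tall b c : c \in tau [:: b] by apply: AR_Ls_mem; rewrite mem_enum.
have [a [s ea]] : exists a s, enum A = a :: s.
  by move: cA; rewrite cardE; case: (enum A) => // a s; exists a, s.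
have thead b : exists p, tau [:: b] = a :: p by rewrite /tau ea; apply: AR_Ls_head.
have t2 b : 1 < size (tau [:: b]).
  apply: leq_trans cA _; rewrite cardE; apply: uniq_leq_size (enum_uniq A) _.
  by move=> c _; apply: tall.
have t2w w : 2 * size w <= size (tau w).
  elim: w => // b w IHw; rewrite (mor_cons tM) size_cat /=; have := t2 b; lia.
have [p tp] := thead a; have [q tq] := AR_Ls_last (enum A) a; rewrite -/tau in tq.
have p0 : p <> [::] by move=> p0; have := t2 a; rewrite tp p0.
have [x [xx x0 x1]] := fixed_point tM tN tp tq p0.
have xa : is_factor x [:: a; a].
  by exists (-1)%R; rewrite !windowS x1; congr [:: _; _]; rewrite -[RHS]x0.
have imx := image_factor tM tN xx.
have xA : word_over x.
  apply: word_over_factor => b; apply/imx; exists [:: a].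
    exact: (@factor_cons _ _ [:: a] a).
  by rewrite infix1s.
exists x; split=> //.
  (* Induction on length, for the images of [x] under all partial products: [AR_L_ext] gives a
     double star, or strips the outermost morphism and shortens the word. When the list is
     exhausted, [x = tau(x)] lets it restart at [enum A]. *)
  have main n : forall s (y : int -> A), is_image (AR_Ls s) x y ->
      forall w, size w < n -> is_factor y w -> double_star y w.
    elim: n => // n IHn s' y xy w wn yw.
    wlog [l [r es]] : s' xy / exists l r, s' = l :: r.
      case: s' xy => [|l r] xy H; last by apply: (H (l :: r)) => //; exists l, r.
      apply: (H (enum A)); last by rewrite ea; eexists _, _; reflexivity.
      suff -> : y = x by [].
      by apply/funext; exact: (is_image_unique id_morphism _ xy (is_image_id x)).
    rewrite {s'}es in xy.
    have rM := AR_Ls_morphism r; have rN := AR_Ls_ne (s := r).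
    have [z xz] := is_image_exists rM rN x.
    have [y' zy] := is_image_exists (AR_L_morphism l) (AR_L_ne (l := l)) z.
    have yy : y = y'.
      apply/funext; apply: (is_image_unique (AR_Ls_morphism (l :: r)) _ xy).
        exact: AR_Ls_ne.
      exact: is_image_comp xz zy.
    rewrite -yy {y' yy} in zy.
    case: (AR_L_ext zy (image_over rM rN xz xA) yw) => // [[v [vw zv e]]].
    apply: double_star_ext e (IHn _ _ xz _ _ zv); lia.
  move=> w; exact: (main (size w).+1 [::] x (is_image_id x)).
move=> u [i xu].
pose rho j := iter j (fun f => tau \o f) (fun w => w).
have rM j : is_morphism (rho j).
  by elim: j => [|j IHj]; [exact: id_morphism | exact: is_morphism_comp IHj tM].
have rN j : non_erasing (rho j).
  by elim: j => [|j IHj] //; apply: non_erasing_comp.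
have rx j : is_image (rho j) x x.
  by elim: j => [|j IHj]; [exact: is_image_id | exact: is_image_comp IHj xx].
have rD j w : rho j (tau w) = tau (rho j w).
  by elim: j => //= j ->.
have rsz j : j < size (rho j [:: a]).
  by elim: j => //= j IHj; have := t2w (rho j [:: a]); lia.
pose N := absz i + size u.
(* [tau] maps [a] to a word ending with [a] and the next letter to a word beginning with [a]. *)
have aab b : infix [:: a; a] (tau (tau [:: b])).
  have [r er] := thead b; have := t2 b; rewrite er.
  case: r er => // c r _ _; rewrite (mor_cons tM) (mor_cons tM c r).
  have [r' ->] := thead c; rewrite tq.
  by apply/infixP; exists q; rewrite cat_rcons /=; eexists; reflexivity.
(* The images of the two letters around the origin reach more than [N] letters to either side, hence
   cover the occurrence of [u] at [i]. *)
have uaa : infix u (rho N [:: a; a]).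
  have [/= e1 _] := rx N 1%N; have [/= _ e2] := rx N 1%N.
  have w1 : window x 0%R 1 = [:: a] by rewrite windowS x0.
  have w2 : window x (- 1%:Z)%R 1 = [:: a] by rewrite windowS x1.
  rewrite w1 in e1; rewrite w2 in e2.
  rewrite (mor_cons (rM N)) -[X in X ++ _]e2 -[X in _ ++ X]e1.
  have -> : 0%R = (- (size (rho N [:: a]))%:Z + (size (rho N [:: a]))%:Z)%R.
    by rewrite addNr.
  rewrite -window_cat -xu; have := rsz N.
  have -> : i = (- (size (rho N [:: a]))%:Z + (absz (i + (size (rho N [:: a]))%:Z)%R)%:Z)%R.
    have := rsz N; rewrite /N; lia.
  by move=> szN; apply: infix_window; rewrite /N in szN *; lia.
exists (rho N.+2); split=> // b.
apply: infix_trans uaa _; rewrite /= -!rD; apply: mor_infix => //.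
Qed.

End BaseWord.

(** * Injectivity from 4-cycles *)

Section Reversal.
Variable A : finType.
Implicit Types (x : int -> A) (w : seq A).

Definition word_rev x : int -> A := fun i => x (- i)%R.

Lemma word_rev_factor x w : is_factor (word_rev x) w <-> is_factor x (rev w).
Proof.
have win i n : window (word_rev x) i n = rev (window x (1 - i - n%:Z)%R n).
  elim: n i => [|n IHn] i //; rewrite windowS IHn windowSr rev_rcons.
  congr (_ :: rev (window x _ _)); rewrite /word_rev; [congr x|]; lia.
split=> -[i e].
  by exists (1 - i - (size w)%:Z)%R; rewrite size_rev -[window _ _ _]revK -win e.
exists (1 - i - (size w)%:Z)%R; rewrite win -[RHS]revK -e size_rev.
by congr (rev (window x _ _)); lia.
Qed.

Lemma word_over_rev x : word_over x -> word_over (word_rev x).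
Proof. by move=> xA a; have [i <-] := xA a; exists (- i)%R; rewrite /word_rev opprK. Qed.

Lemma dendric_rev x : dendric x -> dendric (word_rev x).
Proof.
move=> xD w /word_rev_factor /xD.
pose f (u : A + A) : A + A := match u with inl a => inr a | inr a => inl a end.
have fK : cancel f f by case.
have fac a b : is_factor (word_rev x) (a :: rcons w b) <->
    is_factor x (b :: rcons (rev w) a).
  by rewrite word_rev_factor -rcons_cons rev_rcons rev_cons.
apply: (tree_iso fK fK).
  move=> [a|b]; rewrite !inE; apply: asbool_equiv_eq; rewrite word_rev_factor.
    by rewrite rev_rcons.
  by rewrite rev_cons.
by move=> [a|b] [a'|b'] //=; apply: asbool_equiv_eq.
Qed.

End Reversal.

Section Path.
Variables (A : finType) (a c d : A).
Hypotheses (ac : a != c) (ad : a != d) (cd : c != d).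

(** The marked morphism fixes [d], sends [a] to [d a c] and any other [z] to [d z]. So [a] is always
    followed by [c], and a letter other than [a] and [d] by [d]. *)
Let t z := if z == d then [::] else if z == a then [:: a; c] else [:: z].
Let H := extend (fun z => d :: t z).
Let nxt e := if e == a then c else d.

Let td z : d \notin t z.
Proof.
rewrite /t; case: (eqVneq z d) => // zd; case: eqP => _; rewrite !inE ?negb_or.
  by rewrite eq_sym ad eq_sym cd.
by rewrite eq_sym.
Qed.

Let t_inj : injective (fun z => head d (t z)).
Proof.
have h z : head d (t z) = z.
  by rewrite /t; case: (eqVneq z d) => [->|_] //; case: eqP => [->|].
by move=> z z'; rewrite !h.
Qed.

Let H_mor : is_morphism H.
Proof.
apply: extend_morphism => b; exists b; rewrite /t inE.
case: (eqVneq b d) => //= _; case: (eqVneq b a) => [->|_]; by rewrite !inE eqxx.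
Qed.

Let H_ne : non_erasing H.
Proof. by move=> b; rewrite /H extend1. Qed.

Let H_next u e b : e != d -> infix [:: e; b] (H u) -> b = nxt e.
Proof.
move=> ed; pose r e b := (e == d) || (b == nxt e).
have pl : path r d (H u).
  elim: u => // z u IHu; rewrite -cat1s /H extend_cat extend1 -/(H u).
  have := marker_head d t u; rewrite -/H /t /=.
  case: (eqVneq z d) => _; first by rewrite /r eqxx.
  case: (eqVneq z a) => [_|za].
    rewrite /= /r /nxt !eqxx /= ?orbT /=.
    case: (H u) IHu => //= h s /[swap] ->; rewrite /r eqxx /= => ->.
    have -> : (c == a) = false by rewrite eq_sym (negPf ac).
    by rewrite eqxx orbT andbT.
  rewrite /= {1 2}/r eqxx /=.
  case: (H u) IHu => //= h s /[swap] ->; rewrite /r eqxx /= => ->.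
  by rewrite ?/nxt (negPf za) eqxx orbT ?andbT.
have so : sorted r (H u) by apply: path_sorted pl.
by move=> /infix_sorted /(_ so) /=; rewrite andbT /r (negPf ed) => /eqP.
Qed.

(** Provides, for any [b] other than [a], the path left [a], right [c], left [d], right [d], left
    [b] in the extension graph of the empty word. *)
Lemma path_word : exists x : int -> A, [/\ word_over x, dendric x,
  is_factor x [:: a; c], is_factor x [:: d; c] &
  forall b, b != a -> is_factor x [:: b; d]].
Proof.
have cA : 1 < #|A|.
  by apply/card_gt1P; exists a, c.
have [x0 [x0A x0D _]] := base_word cA.
have [x xx] := is_image_exists H_mor H_ne x0.
have imx := image_factor H_mor H_ne xx.
exists x; split.
- exact: image_over xx x0A.
- apply: (marker_dendric td t_inj H_mor xx (nxt := nxt)) => // e b ed.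
  by case/imx => u _; apply: H_next.
- apply/imx; exists [:: a]; first exact: factor1.
  rewrite /H extend1 /t (negPf ad) eqxx; apply/infixP.
  by exists [:: d], [::].
- apply/imx; exists [:: c]; first exact: factor1.
  rewrite /H extend1 /t (negPf cd) eq_sym (negPf ac); apply/infixP.
  by exists [::], [::].
move=> b ba; have [e x0e] := factor_extr (factor1 x0A b).
apply/imx; exists [:: b; e] => //; apply/infixP.
rewrite /H /extend /= {1}/t (negPf ba); case: (eqVneq b d) => [->|_].
  by exists [::]; eexists; reflexivity.
by exists [:: d]; eexists; reflexivity.
Qed.

End Path.

Section Injective.
Variables (A B : finType).

(* If g identifies a and b but not d, and f separates c and d, the path
   a - c - d - d - b of the word of [path_word] closes up to a 4-cycle. *)
Lemma left_letters_inj (g f : A -> B) (w : seq B) :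
  (forall x, word_over x -> dendric x -> exists y, dendric y /\
     forall a b, is_factor x [:: a; b] -> is_factor y (g a :: rcons w (f b))) ->
  (exists a b, g a <> g b) -> (exists a b, f a <> f b) -> injective g.
Proof.
move=> H [a1 [a2 ga]] [c1 [c2 fc]] a b gab; apply: contrapT => ab.
have [d gd] : exists d, g d <> g a.
  apply: contrapT => no; apply: ga.
  have all z : g z = g a by apply: contrapT => gz; apply: no; exists z.
  by rewrite !all.
have [c fcd] : exists c, f c <> f d.
  apply: contrapT => no; apply: fc.
  have all z : f z = f d by apply: contrapT => gz; apply: no; exists z.
  by rewrite !all.
(* At least one of [a] and [b] differs from [c], and their roles are symmetric. *)
wlog ac : a b gab ab gd / a <> c.
  move=> W; have [|ac] := pselect (a <> c); first exact: W gab ab gd.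
  apply: (W b a) => //; first by move=> /esym.
    by rewrite -gab.
  by move=> bc; apply: ac => ac; apply: ab; rewrite ac bc.
have ad : a <> d by move=> e; apply: gd; rewrite e.
have cd : c <> d by move=> e; apply: fcd; rewrite e.
have /eqP ac' := ac; have /eqP ad' := ad; have /eqP cd' := cd.
have [x [xA xD x1 x2 x3]] := path_word ac' ad' cd'.
have [y [yD /[dup] yp /(_ _ _ x1) y1]] := H x xA xD.
(* The edge from [b] to [d] becomes an edge at [g a], because [g a = g b]. It closes the cycle
   [g a], [f c], [g d], [f d]. *)
have y3 : is_factor y (g a :: rcons w (f d)).
  by rewrite gab; apply/yp/x3/eqP => /esym.
apply: (dendric_cycle4 yD _ fcd y1 y3 (yp _ _ x2)); first by move/esym.
by apply/yp/x3; rewrite eq_sym.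
Qed.

Lemma right_letters_inj (g f : A -> B) (w : seq B) :
  (forall x, word_over x -> dendric x -> exists y, dendric y /\
     forall a b, is_factor x [:: a; b] -> is_factor y (g a :: rcons w (f b))) ->
  (exists a b, g a <> g b) -> (exists a b, f a <> f b) -> injective f.
Proof.
move=> H gn fn; apply: (@left_letters_inj f g (rev w)) => // x xA xD.
have [y [yD yp]] := H _ (word_over_rev xA) (dendric_rev xD).
exists (word_rev y); split=> [|a b xab]; first exact: dendric_rev.
apply/word_rev_factor; rewrite rev_cons rev_rcons revK; apply: yp.
exact/word_rev_factor.
Qed.

End Injective.

(** * Consequences of connectedness *)

Lemma int_argmax (f : int -> int) (K : int) : (forall i, f i <= K)%R ->
  exists i, forall j, (f j <= f i)%R.
Proof.
move=> fK; suff H n : forall i, (K - f i <= n%:Z)%R -> exists i, forall j, (f j <= f i)%R.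
  by apply: (H (absz (K - f 0%R))%R 0%R); have := fK 0%R; lia.
elim: n => [|n IHn] i Ki; first by exists i => j; have := fK j; lia.
have [[j fj]|no] := pselect (exists j, (f i < f j)%R).
  by apply: (IHn j); lia.
exists i => j; have [//|fij] := boolP (f j <= f i)%R.
by case: no; exists j; lia.
Qed.

(** The word [w] starts inside some block, leaves it after at most [M] letters, and has room for the
    whole next block. *)
Lemma long_infix (A B : finType) (kappa : seq A -> seq B) M (v : seq A) (w : seq B) :
  is_morphism kappa -> (forall a, size (kappa [:: a]) <= M) -> 0 < M ->
  2 * M <= size w -> infix w (kappa v) -> exists a, infix (kappa [:: a]) w.
Proof.
move=> kM kB M0 wM wv.
have [p [q]] : exists p q : seq B, kappa v = p ++ w ++ q by exact/infixP.
elim: v p {wv} => [|a v IHv] p; first by rewrite (mor0 kM); case: p w wM => [|? ?] [|? ?] //=; lia.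
rewrite (mor_cons kM) => /cat_eq_cat[[p' _ /IHv//]|[b [r [ea e]]]].
have rM : size r < M by have := kB a; rewrite ea size_cat /=; lia.
have {}e : w ++ q = (b :: r) ++ kappa v by rewrite e.
case: v {IHv} e => [|c v].
  rewrite (mor0 kM) cats0 => /(congr1 size); rewrite size_cat /= => se.
  by exfalso; lia.
rewrite (mor_cons kM) catA => /cat_eq_cat[[s e _]|[d [s [-> _]]]].
  have := congr1 size e; rewrite !size_cat /= => se.
  have s0 : s = [::] by apply: size0nil; have := kB c; lia.
  exists c; rewrite -[w]cats0 -s0 -e.
  by apply/infixP; exists (b :: r), [::]; rewrite cats0.
by exists c; apply/infixP; exists (b :: r), (d :: s); rewrite -catA.
Qed.

Lemma null_weight (A B : finType) (sigma : seq A -> seq B) : #|A| < #|B| ->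
  exists psi : B -> int, (exists b, psi b <> 0%R) /\
    forall a, (\sum_(b <- sigma [:: a]) psi b = 0)%R.
Proof.
move=> cAB.
pose M := (\matrix_(i < #|B|, j < #|A|)
  (count_mem (enum_val i) (sigma [:: enum_val j]))%:R : 'M[rat]_(#|B|, #|A|))%R.
have /rowV0Pn[v /sub_kermxP vM v0] : kermx M != 0%R.
  by rewrite kermx_eq0 neq_ltn (leq_ltn_trans (rank_leq_col _)).
pose q b := v ord0 (enum_rank b).
(* The product of all the other denominators, so that [psi] is [q] times the common factor [D]. *)
pose den b := \big[*%R/1%R]_(b' | b' != b) denq (q b').
pose psi b := (numq (q b) * den b)%R.
pose D := (\prod_b denq (q b))%R.
have D0 : D != 0%R by apply/prodf_neq0 => b _; apply: denq_neq0.
have psiE b : ((psi b)%:~R = D%:~R * q b :> rat)%R.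
  rewrite /psi /D (bigD1 b) //= !intrM -/(den b) numqE.
  by rewrite -[LHS]mulrA [LHS]mulrC.
have zero a : (\sum_(b <- sigma [:: a]) q b = 0)%R.
  have /rowP/(_ (enum_rank a)) := vM; rewrite !mxE => vMa.
  have cnt (s : seq B) : (\sum_(b <- s) q b = \sum_b q b * (count_mem b s)%:R)%R.
    elim: s => [|c s IHs]; first by rewrite big_nil big1 // => b _; rewrite mulr0.
    have one : (\sum_b q b * (c == b)%:R = q c)%R.
      rewrite (bigD1 c) //= eqxx mulr1 big1 ?addr0 // => b bc.
      by rewrite eq_sym (negPf bc) mulr0.
    rewrite big_cons IHs -[in LHS]one -big_split /=.
    by apply: eq_bigr => b _; rewrite natrD mulrDr.
  rewrite cnt -[RHS]vMa (reindex (fun i : 'I_#|B| => enum_val i)) /=; last first.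
    by exists enum_rank => ? _; rewrite (enum_valK, enum_rankK).
  by apply: eq_bigr => i _; rewrite !mxE /q enum_valK enum_rankK.
exists psi; split.
  have [i vi] : exists i, v ord0 i != 0%R.
    apply: contrapT => no; case/eqP: v0; apply/rowP => i; rewrite mxE.
    by apply/eqP/negPn/negP => vi; apply: no; exists i.
  exists (enum_val i) => psi0; have := psiE (enum_val i).
  by rewrite psi0 /q enum_valK => /esym/eqP; rewrite mulf_eq0 intr_eq0 (negPf D0) (negPf vi).
move=> a; apply/eqP; rewrite -(intr_eq0 rat) rmorph_sum /=.
by rewrite (eq_bigr _ (fun b _ => psiE b)) -mulr_sumr zero mulr0.
Qed.

(** Otherwise take a null weight [psi]. The sums [S] of the weights along [y] are bounded, and a
    window showing both a maximum and a minimum of [S] reveals its level. By uniform recurrence all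
    long windows contain such a window, so [S] is constant and [psi] vanishes. *)
Lemma dendric_image_card (A B : finType) (sigma : seq A -> seq B) :
  1 < #|A| -> is_morphism sigma -> non_erasing sigma -> dendric_preserving sigma ->
  #|B| <= #|A|.
Proof.
move=> cA sM sN sD; rewrite leqNgt; apply/negP => /(null_weight sigma)[psi [[b0 psi0] zero]].
have [x [xA xds xur]] := base_word cA.
have xD : dendric x by move=> w /xds /double_star_tree.
have [y xy] := is_image_exists sM sN x.
have yD := sD x xA xD y xy; have yB := image_over sM sN xy xA.
pose wt (w : seq B) : int := (\sum_(b <- w) psi b)%R.
have wt_cat u v : (wt (u ++ v) = wt u + wt v)%R by rewrite /wt big_cat.
have wt_im u : wt (sigma u) = 0%R.
  elim: u => [|a u IHu]; first by rewrite (mor0 sM) /wt big_nil.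
  by rewrite (mor_cons sM) wt_cat IHu addr0; apply: zero.
(* Whole blocks weigh zero, so a prefix of an image weighs as much as a part of a single block, at
   most [K] in absolute value. *)
pose K := \sum_a \sum_(b <- sigma [:: a]) absz (psi b).
have wt_abs w : absz (wt w) <= \sum_(b <- w) absz (psi b).
  elim: w => [|b w IHw]; first by rewrite /wt !big_nil.
  rewrite big_cons /wt big_cons -/(wt w); lia.
have wt_prefix u p q : sigma u = p ++ q -> absz (wt p) <= K.
  elim: u p => [|a u IHu] p.
    by rewrite (mor0 sM); case: p => // _; rewrite /wt big_nil.
  rewrite (mor_cons sM) => /cat_eq_cat[[w -> /IHu wK]|[b [w [ea _]]]].
    by rewrite wt_cat wt_im add0r.
  apply: leq_trans (wt_abs _) _.
  rewrite /K (bigD1 a) //= ea big_cat /= -addnA; exact: leq_addr.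
have wt_factor w : is_factor y w -> absz (wt w) <= 2 * K.
  case/(image_factor sM sN xy) => u _ /infixP[p [q e]].
  have := wt_prefix _ _ _ e; rewrite catA in e; have := wt_prefix _ _ _ e.
  rewrite wt_cat; lia.
pose S (i : int) : int := match i with
  | Posz n => wt (window y 0%R n)
  | Negz n => (- wt (window y (Negz n) n.+1))%R end.
have S1 i : (S (i + 1) = S i + psi (y i))%R.
  have wtr w b : (wt (rcons w b) = wt w + psi b)%R.
    by rewrite -cats1 wt_cat /wt big_seq1.
  have wtl w b : (wt (b :: w) = psi b + wt w)%R by rewrite /wt big_cons.
  case: i => [n|[|n]].
  - have -> : (Posz n + 1 = Posz n.+1)%R by lia.
    by rewrite /S windowSr wtr add0r.
  - by rewrite /S windowS wtl /= /wt !big_nil addr0 addNr.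
  have -> : (Negz n.+1 + 1 = Negz n)%R by lia.
  rewrite /S [in RHS]windowS wtl.
  have -> : (Negz n.+1 + 1 = Negz n)%R by lia.
  by rewrite opprD addrAC addNr add0r.
have Sn n i : (S (i + n%:Z) = S i + wt (window y i n))%R.
  elim: n i => [|n IHn] i; first by rewrite /wt big_nil !addr0.
  rewrite windowS /wt big_cons -/(wt _) addrA -S1 -IHn; congr S; lia.
have SK i : (- (2 * K)%:Z <= S i <= (2 * K)%:Z)%R.
  case: i => n; rewrite /S; set w := window _ _ _.
    have := wt_factor w (window_factor _ _ _); lia.
  have := wt_factor w (window_factor _ _ _); lia.
have [i1 max] : exists i, forall j, (S j <= S i)%R.
  by apply: (@int_argmax _ (2 * K)%:Z) => i; case/andP: (SK i).
have [i0 min] : exists i, forall j, (S i <= S j)%R.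
  have [|i mi] := @int_argmax (fun i => - S i)%R (2 * K)%:Z.
    by move=> i; have := SK i; lia.
  by exists i => j; have := mi j; lia.
pose N := absz i0 + absz i1.
pose W := window y (- N%:Z)%R (N + N).+1.
(* Differences of [S] are read off the letters, so a copy of [W] at another level would exceed the
   maximum or undercut the minimum. *)
have pin j : window y j (N + N).+1 = W -> S j = S (- N%:Z)%R.
  move=> jW.
  have sub k : k <= (N + N).+1 ->
      (S (j + k%:Z) - S j = S (- N%:Z + k%:Z) - S (- N%:Z))%R.
    move=> kN; rewrite !Sn !(addrC (S _)) !addrK.
    have tk m : window y m k = take k (window y m (N + N).+1).
      by rewrite -(subnKC kN) window_cat take_size_cat // size_window.
    by rewrite !tk jW.
  have e1 : i1 = (- N%:Z + (absz (i1 + N%:Z)%R)%:Z)%R by rewrite /N; lia.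
  have e0 : i0 = (- N%:Z + (absz (i0 + N%:Z)%R)%:Z)%R by rewrite /N; lia.
  have := sub (absz (i1 + N%:Z)%R); have := sub (absz (i0 + N%:Z)%R).
  rewrite -e1 -e0 => /(_ _)s0 /(_ _)s1.
  have {}s0 := s0 ltac:(rewrite /N; lia); have {}s1 := s1 ltac:(rewrite /N; lia).
  have := max (j + (absz (i1 + N%:Z)%R)%:Z)%R; have := min (j + (absz (i0 + N%:Z)%R)%:Z)%R.
  lia.
(* A window of length [2 * M] contains a whole block of [sigma \o rho], and each such block contains
   [W]. *)
have [C urW] : exists C, forall i, infix W (window y i C).
  have /(image_factor sM sN xy)[u xu Wu] := window_factor y (- N%:Z)%R (N + N).+1.
  have [rho [rM rN rx ur]] := xur u xu.
  have kM := is_morphism_comp rM sM; have kN := non_erasing_comp sM rN sN.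
  pose M := \sum_a size (sigma (rho [:: a])).
  have kB a : size ((sigma \o rho) [:: a]) <= M.
    by rewrite /M (bigD1 a) //= leq_addr.
  have M0 : 0 < M.
    apply: leq_trans (kB (x 0%R)); rewrite lt0n size_eq0.
    by apply/eqP; apply: kN.
  exists (2 * M) => i.
  have /(image_factor kM kN (is_image_comp rx xy))[v _ iv] := window_factor y i (2 * M).
  have [|a ka] := long_infix kM kB M0 _ iv; first by rewrite size_window.
  apply: infix_trans ka; apply: infix_trans Wu _.
  by apply: mor_infix => //; apply: ur.
have Sdet i j : window y i C = window y j C -> S i = S j.
  move=> ij; have /infixP[p [q ei]] := urW i.
  have at_p k : window y k C = p ++ W ++ q -> (S k = S (- N%:Z) - wt p)%R.
    have -> : C = size p + ((N + N).+1 + size q).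
      by rewrite -[LHS](size_window y i) ei !size_cat size_window.
    rewrite !window_cat => /eqP; rewrite eqseq_cat ?size_window // => /andP[/eqP ep].
    rewrite eqseq_cat ?size_window // => /andP[/eqP /pin <- _].
    by rewrite Sn ep addrK.
  by rewrite (at_p i ei) (at_p j) // -ij.
have Sc := dendric_state_const yD (h := fun s b => (s + psi b)%R) S1 Sdet.
have [i yi] := yB b0; apply: psi0; rewrite -yi.
by have := S1 i; rewrite (Sc (i + 1)%R i) => /eqP; rewrite -{1}[S i]addr0 (inj_eq (addrI _)) => /eqP <-.
Qed.

(** If all images commute with [z = sigma [:: c]], then [y] has period [P = size z]. The window of
    length [P] is then a state updated by rotation, hence constant, and [y] would have a single
    letter. *)
Lemma dendric_noncommuting (A B : finType) (sigma : seq A -> seq B) :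
  1 < #|A| -> 1 < #|B| ->
  is_morphism sigma -> non_erasing sigma -> dendric_preserving sigma ->
  exists a b, sigma [:: a; b] <> sigma [:: b; a].
Proof.
move=> cA cB sM sN sD; apply: contrapT => no.
have [x [xA xds _]] := base_word cA.
have xD : dendric x by move=> w /xds /double_star_tree.
have [y xy] := is_image_exists sM sN x.
have yD := sD x xA xD y xy; have yB := image_over sM sN xy xA.
pose c := x 0%R; pose z := sigma [:: c]; pose P := size z.
have P0 : 0 < P by rewrite lt0n size_eq0; apply/eqP/sN.
have comm u : sigma u ++ z = z ++ sigma u.
  elim: u => [|a u IHu]; first by rewrite (mor0 sM) cats0.
  rewrite (mor_cons sM) -catA IHu !catA; congr (_ ++ _).
  rewrite /z -!(mor_cat sM) /=; apply: contrapT => ac; apply: no.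
  by exists a, c.
have per i : y (i + P%:Z)%R = y i.
  have /(image_factor sM sN xy)[u _ iu] := window_factor y i P.+1.
  have [p [q e]] : exists p q : seq B, sigma u = p ++ window y i P.+1 ++ q.
    exact/infixP.
  have := congr1 (fun w => nth (y i) w (size p + P)) (comm u).
  have su : size p + P < size (sigma u) by rewrite e !size_cat size_window; lia.
  rewrite /= !nth_cat su ifN -?leqNgt ?leq_addl // addnK e !nth_cat !ltnn.
  rewrite ifN -?leqNgt ?leq_addr // addKn subnn !size_window ltnSn /=.
  by rewrite !nth_mkseq // addr0.
have S1 i : window y (i + 1)%R P = rot 1 (window y i P).
  case: P P0 per => // n _ per; rewrite windowSr [in RHS]windowS rot1_cons.
  by congr rcons; rewrite -[RHS]per; congr y; lia.
have Sc := dendric_state_const yD (h := fun s _ => rot 1 s) S1 (fun i j e => e).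
have yc i j : y i = y j.
  by have := Sc i j; case: P P0 {Sc S1 per} => // n _; rewrite !windowS => -[].
have /card_gt1P[b [b' [_ _ /eqP]]] := cB.
by have [i <-] := yB b; have [j <-] := yB b'; case; apply: yc.
Qed.

(** * The star of the empty word *)

Lemma dendric_preserving_comp (A B C : finType) (t : seq A -> seq B) (s : seq B -> seq C) :
  is_morphism t -> non_erasing t -> is_morphism s -> non_erasing s ->
  dendric_preserving t -> dendric_preserving s -> dendric_preserving (s \o t).
Proof.
move=> tM tN sM sN tD sD x xA xD z xz.
have [y xy] := is_image_exists tM tN x; have [z' yz] := is_image_exists sM sN y.
have -> : z = z'.
  apply/funext; apply: (is_image_unique _ _ xz (is_image_comp xy yz)).
    exact: is_morphism_comp.
  exact: non_erasing_comp.
exact: sD (image_over tM tN xy xA) (tD x xA xD y xy) _ yz.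
Qed.

Lemma AR_L_preserving (A : finType) (l : A) : dendric_preserving (AR_L l).
Proof. by move=> x xA xD y xy; apply: AR_L_dendric xy xA xD. Qed.

Lemma AR_R_preserving (A : finType) (l : A) : dendric_preserving (AR_R l).
Proof.
move=> x xA xD z xz.
have [y xy] := is_image_exists (AR_L_morphism l) (@AR_L_ne _ l) x.
exact: dendric_lang (AR_R_factor xy xz) (AR_L_preserving xA xD xy).
Qed.

(** Here [p] is the longest common prefix and [f z] the letter after it. A difference within the
    first [n] letters, which all the images have, makes [p] end before any of them. *)
Lemma split_prefix (A B : finType) (k : A -> seq B) n a b :
  (forall z, n <= size (k z)) -> take n (k a) <> take n (k b) ->
  exists p (f : A -> B), (forall z, prefix (rcons p (f z)) (k z)) /\
    exists a b, f a <> f b.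
Proof.
elim: n k => [|n IHn] k kn kab; first by rewrite !take0 in kab.
have [b0 _] : exists b0 : B, True by case: (k a) (kn a) => // b0; exists b0.
pose f z := head b0 (k z).
have kE z : k z = f z :: behead (k z) by rewrite /f; case: (k z) (kn z).
have [fn|fc] := pselect (exists a b, f a <> f b).
  exists [::], f; split=> // z; rewrite [k z]kE /= eqxx.
  exact: prefix0s.
have fa z : f z = f a by apply: contrapT => za; apply: fc; exists z, a.
have [||p [g [pg gn]]] := IHn (fun z => behead (k z)).
- by move=> z; rewrite size_behead; have := kn z; case: (size _).
- by move=> e; apply: kab; rewrite (kE a) (kE b) /= e fa.
exists (f a :: p), g; split=> // z; rewrite [k z]kE fa /= eqxx.
exact: pg.
Qed.

Section Star.
Variables (A B : finType) (sigma : seq A -> seq B).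
Hypotheses (cA : 1 < #|A|) (cB : 1 < #|B|).
Hypotheses (sM : is_morphism sigma) (sN : non_erasing sigma) (sD : dendric_preserving sigma).

Lemma letter_star : exists x y l l', [/\ word_over x, is_image sigma x y &
  forall u v, is_factor y [:: u; v] <-> u = l' \/ v = l].
Proof.
have [a [b ab]] := dendric_noncommuting cA cB sM sN sD.
have nab : a != b by apply/eqP => e; apply: ab; rewrite e.
have nba : b != a by rewrite eq_sym.
pose tL := AR_L a \o AR_L b; pose tR := AR_R a \o AR_R b.
have tLM : is_morphism tL := is_morphism_comp (AR_L_morphism b) (AR_L_morphism a).
have tLN : non_erasing tL := non_erasing_comp (AR_L_morphism a) (@AR_L_ne _ b) (@AR_L_ne _ a).
have tRM : is_morphism tR := is_morphism_comp (AR_R_morphism b) (AR_R_morphism a).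
have tLD : dendric_preserving tL.
  apply: dendric_preserving_comp; try exact: AR_L_preserving;
    try exact: AR_L_morphism; exact: AR_L_ne.
have Laa : AR_L a [:: a] = [:: a] by rewrite /AR_L extend1 eqxx.
have Lab : AR_L a [:: b] = [:: a; b] by rewrite /AR_L extend1 (negPf nba).
have Raa : AR_R a [:: a] = [:: a] by rewrite /AR_R extend1 eqxx.
have Rab : AR_R a [:: b] = [:: b; a] by rewrite /AR_R extend1 (negPf nba).
have tLa : tL [:: a] = [:: a; b; a].
  rewrite /tL /= {2}/AR_L extend1 (negPf nab).
  by rewrite (mor_cons (AR_L_morphism a)) Laa Lab.
have tLb : tL [:: b] = [:: a; b] by rewrite /tL /= {2}/AR_L extend1 eqxx.
have tRa : tR [:: a] = [:: a; b; a].
  rewrite /tR /= {2}/AR_R extend1 (negPf nab).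
  by rewrite (mor_cons (AR_R_morphism a)) Raa Rab.
have tRb : tR [:: b] = [:: b; a] by rewrite /tR /= {2}/AR_R extend1 eqxx.
have tLz z : exists r, tL [:: z] = [:: a; b] ++ r.
  rewrite /tL /= {2}/AR_L extend1; case: eqP => _; first by exists [::].
  by rewrite (mor_cons (AR_L_morphism a)) Lab; eexists; reflexivity.
have tRz z : exists r, tR [:: z] = r ++ [:: b; a].
  rewrite /tR /= {2}/AR_R extend1; case: eqP => _; first by exists [::].
  by rewrite (mor_cons (AR_R_morphism a)) Rab; eexists; reflexivity.
(* Sliding [aba] through [u] turns [tL] into [tR]. This will put [aba] between the end of a block of
   [tL] and the start of a block of [tR]. *)
have conj u : tL u ++ [:: a; b; a] = [:: a; b; a] ++ tR u.
  have e := AR_R_conj b u.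
  have := congr1 (AR_L a) e; rewrite (mor_rcons (AR_L_morphism a)).
  rewrite (mor_cons (AR_L_morphism a)) Lab => {}e.
  rewrite -[[:: a; b; a]]/([:: a; b] ++ [:: a]) catA -e -!catA.
  by rewrite -[[:: a] ++ tR u]/(a :: AR_R a (AR_R b u)) AR_R_conj cats1.
(* All images under [sigma \o tL] and [sigma \o tR] have at least [n] letters. The last,
   respectively first, [n] letters are sigma(ab) for one of [a], [b] and sigma(ba) for the other.
   The common suffix is obtained as a prefix of the reversed words. *)
pose n := size (sigma [:: a; b]).
have nE : n = size (sigma [:: b; a]).
  by rewrite /n (mor_cons sM a) (mor_cons sM b [:: a]) !size_cat addnC.
have [||s [g [sg gn]]] := @split_prefix _ _ (fun z => rev (sigma (tL [:: z]))) n a b.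
- move=> z; have [r ->] := tLz z.
  by rewrite size_rev (mor_cat sM) size_cat leq_addr.
- rewrite tLa tLb (mor_cons sM a [:: b; a]) rev_cat take_size_cat ?size_rev //.
  by rewrite take_oversize ?size_rev // => /(can_inj revK)/esym.
have [||p [f [pf fn]]] := @split_prefix _ _ (fun z => sigma (tR [:: z])) n a b.
- move=> z; have [r ->] := tRz z.
  by rewrite (mor_cat sM) size_cat nE leq_addl.
- rewrite tRa tRb -[[:: a; b; a]]/([:: a; b] ++ [:: a]) (mor_cat sM).
  by rewrite take_size_cat // take_oversize // nE.
pose w := rev s ++ sigma [:: a; b; a] ++ p.
have key x y : word_over x -> dendric x -> is_image (sigma \o tL) x y ->
    dendric y /\ forall z z', is_factor x [:: z; z'] ->
      is_factor y (g z :: rcons w (f z')).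
  move=> xA xD xy; have sLM := is_morphism_comp tLM sM.
  have sLN := non_erasing_comp sM tLN sN.
  split; first exact: dendric_preserving_comp tLM tLN sM sN tLD sD _ xA xD _ xy.
  (* Three further letters make the image under [tL] long enough to begin with [aba]. *)
  move=> z z' /(factor_extrn 3)[v v3 xv].
  apply/(image_factor sLM sLN xy); eexists; first exact: xv.
  have [q vq] : exists q, tL v = [:: a; b; a] ++ q.
    exists (drop 3 (tL v)); have := congr1 (take 3) (conj v).
    rewrite takel_cat; last by rewrite -v3 leq_size_image.
    by rewrite take_size_cat // => <-; rewrite cat_take_drop.
  rewrite -[(sigma \o tL) _]/(sigma (tL ([:: z] ++ [:: z'] ++ v))).
  rewrite 2!(mor_cat tLM) vq (catA (tL [:: z'])) conj -catA !(mor_cat sM).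
  have /prefixP[r1 e1] := sg z; have /prefixP[r2 ->] := pf z'.
  have -> : sigma (tL [:: z]) = rev r1 ++ g z :: rev s.
    by rewrite -[LHS]revK e1 rev_cat rev_rcons.
  apply/infixP; exists (rev r1), (r2 ++ sigma q).
  by rewrite /w -cats1 -!catA /= -?catA /= -cats1 -!catA.
have ginj : injective g.
  apply: (left_letters_inj _ gn fn) => x xA xD.
  have [y xy] := is_image_exists (is_morphism_comp tLM sM) (non_erasing_comp sM tLN sN) x.
  by exists y; apply: key.
have finj : injective f.
  apply: (right_letters_inj _ gn fn) => x xA xD.
  have [y xy] := is_image_exists (is_morphism_comp tLM sM) (non_erasing_comp sM tLN sN) x.
  by exists y; apply: key.
(* With [#|B| <= #|A|], the injections [g] and [f] are onto, so [w] extends by every letter on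
   either side. *)
have cBA := dendric_image_card cA sM sN sD.
have [g' _ gK] := inj_card_bij ginj cBA; have [f' _ fK] := inj_card_bij finj cBA.
have [x0 [x0A x0ds _]] := base_word cA.
have x0D : dendric x0 by move=> v /x0ds /double_star_tree.
have [x x0x] := is_image_exists tLM tLN x0.
have [y xy] := is_image_exists sM sN x.
have [yD yw] := key x0 y x0A x0D (is_image_comp x0x xy).
have [c [r aE]] : exists c r, sigma [:: a; b; a] = c :: r.
  rewrite (mor_cons sM); case: (sigma [:: a]) (@sN a) => // c r _.
  by eexists _, _; reflexivity.
have [l [w1 wl]] : exists l w1, w = l :: w1.
  by rewrite /w aE; case: (rev s) => [|l w1]; eexists _, _; reflexivity.
have [l' [w2 wl']] : exists l' w2, w = rcons w2 l'.
  by rewrite wl; case/lastP: (w1) => [|w2 l']; [exists l, [::] | exists l', (l :: w2)].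
have yl u : is_factor y [:: u; l].
  have [e xe] := factor_extr (factor1 x0A (g' u)).
  have := yw _ _ xe; rewrite gK wl; apply: factor_infix.
  by apply/infixP; exists [::]; eexists; reflexivity.
have yl' v : is_factor y [:: l'; v].
  have [e xe] := factor_extl (factor1 x0A (f' v)).
  have := yw _ _ xe; rewrite fK wl'; apply: factor_infix.
  by apply/infixP; exists (g e :: w2), [::]; rewrite -!cats1 /= -catA.
exists x, y, l, l'; have xA := image_over tLM tLN x0x x0A; split=> //.
move=> u v; split=> [yuv|[->|->]//].
have [->|ul] := pselect (u = l'); first by left.
have [->|vl] := pselect (v = l); first by right.
(* Any other pair closes a cycle through [u], [l'] on the left and [l], [v] on the right. *)
by case: (dendric_cycle4 (w := [::]) yD ul vl yuv (yl u) (yl' v) (yl' l)).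
Qed.

Lemma pair_infix w u v : infix [:: u; v] (sigma w) ->
  (exists z, infix [:: u; v] (sigma [:: z])) \/
  exists z z', infix [:: z; z'] w /\ infix [:: u; v] (sigma [:: z; z']).
Proof.
elim: w => [|z w IHw]; first by rewrite (mor0 sM).
case: w IHw => [|z' w] IHw uv; first by left; exists z.
have ext : infix [:: u; v] (sigma (z' :: w)) -> (exists z, infix [:: u; v] (sigma [:: z])) \/
  exists z0 z0', infix [:: z0; z0'] [:: z, z' & w] /\ infix [:: u; v] (sigma [:: z0; z0']).
  move=> /IHw[|[e [e' [ee uv']]]]; [by left|right; exists e, e'; split=> //].
  exact: infix_trans ee (infix_cons _ _).
move: uv; rewrite (mor_cons sM) => /infixP[p [q]].
move=> /cat_eq_cat[[p' _ e]|[c [r [ez e]]]].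
  by apply: ext; apply/infixP; exists p', q.
case: r ez e => [|c' r] ez; last first.
  move=> [eu ev _]; left; exists z; rewrite ez eu ev; apply/infixP.
  by exists p, r.
rewrite cat0s => -[-> ev]; right; exists z, z'; split.
  by apply/infixP; exists [::], w.
rewrite (mor_cons sM) ez; move: ev; rewrite (mor_cons sM).
case: (sigma [:: z']) (@sN z') => // d r _ [-> _].
by apply/infixP; exists p, r; rewrite -catA.
Qed.

End Star.

Lemma infix2_cat (T : eqType) (w1 w2 : seq T) u v : infix [:: u; v] (w1 ++ w2) ->
  [\/ infix [:: u; v] w1, infix [:: u; v] w2 |
      exists r1 r2, w1 = rcons r1 u /\ w2 = v :: r2].
Proof.
move=> /infixP[p [q]] /cat_eq_cat[[p' _ ->]|[c [r [->]]]].
  by constructor 2; apply/infixP; exists p', q.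
case: r => [|c' r] /=; last first.
  by case=> -> -> _; constructor 1; apply/infixP; exists p, r.
by case=> -> <-; constructor 3; exists p, q; rewrite cats1.
Qed.

Lemma mem_split (T : eqType) (a : T) w : a \in w -> exists p q, w = p ++ a :: q.
Proof. by case/splitPr=> p q; exists p, q. Qed.

Lemma constant_after (T : eqType) (l : T) w p q :
  (forall v, infix [:: l; v] w -> v = l) -> w = p ++ l :: q -> forall e, e \in q -> e = l.
Proof.
move=> wl; elim: q p => // c q IHq p ew e.
have ec : c = l by apply: wl; rewrite ew; apply/infixP; exists p, q.
subst c; rewrite inE => /predU1P[//|]; apply: (IHq (rcons p l)).
by rewrite cat_rcons.
Qed.

Section StarAt.
Variables (A B : finType) (sigma : seq A -> seq B).
Hypotheses (cA : 1 < #|A|) (cB : 1 < #|B|).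
Hypotheses (sM : is_morphism sigma) (sN : non_erasing sigma) (sD : dendric_preserving sigma).

(** Apply [letter_star] to [sigma \o AR_L c]: the pairs of letters of an image under [AR_L c] are
    those containing [c], so the pairs of [y] are those of the words sigma(cz) and sigma(zc). *)
Lemma star_at c : exists l, forall u v,
  (exists z, infix [:: u; v] (sigma [:: c; z]) \/ infix [:: u; v] (sigma [:: z; c]))
  <-> u = l \/ v = l.
Proof.
have LM := AR_L_morphism c; have LN := @AR_L_ne _ c.
have sLM := is_morphism_comp LM sM; have sLN := non_erasing_comp sM LN sN.
have sLD := dendric_preserving_comp LM LN sM sN (@AR_L_preserving _ c) sD.
have [x [y [l [l' [xA xy yP]]]]] := letter_star cA cB sLM sLN sLD.
have [x1 xx1] := is_image_exists LM LN x; have [y' x1y] := is_image_exists sM sN x1.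
have ey : y = y'.
  apply/funext; exact: (is_image_unique sLM sLN xy (is_image_comp xx1 x1y)).
rewrite -{}ey {y'} in x1y.
have imy := image_factor sM sN x1y.
have E u v : (exists z, infix [:: u; v] (sigma [:: c; z]) \/
      infix [:: u; v] (sigma [:: z; c])) <-> u = l' \/ v = l.
  rewrite -yP imy; split.
    by case=> z [uv|uv]; [exists [:: c; z]|exists [:: z; c]] => //;
       apply/(AR_L_pairs xx1 xA); [left|right].
  case=> w xw /(pair_infix sM sN)[[z uv]|[z [z' [zz uv]]]].
    by exists z; left; rewrite (mor_cons sM); apply: infix_catl.
  have /(AR_L_pairs xx1 xA)[ec|ec] := factor_infix zz xw; rewrite ec in uv.
    by exists z'; left.
  by exists z; right.
suff ll : l = l' by exists l => u v; rewrite E ll.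
(* If the centres differ, [l] is followed only by [l] and [l'] is preceded only by [l']. As [l]
   occurs in some sigma(a), all letters of sigma(c) equal [l], by sigma(ac); symmetrically they all
   equal [l']. *)
apply: contrapT => ll.
have [h hc] : exists h, h \in sigma [:: c].
  by case: (sigma [:: c]) (@sN c) => // h r _; exists h; rewrite inE eqxx.
suff [hl hl'] : h = l /\ h = l' by apply: ll; rewrite -hl.
have [_ _ sS] := sM; split.
  have [a /mem_split[p [q ea]]] := sS l.
  have e : sigma [:: a; c] = p ++ l :: (q ++ sigma [:: c]).
    by rewrite (mor_cons sM) ea -catA.
  apply: (constant_after _ e); last by rewrite mem_cat hc orbT.
  by move=> v uv; have /E[|] : exists z, infix [:: l; v] (sigma [:: c; z]) \/
      infix [:: l; v] (sigma [:: z; c]) by exists a; right.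
have [a /mem_split[p [q ea]]] := sS l'.
have e : rev (sigma [:: c; a]) = rev q ++ l' :: (rev p ++ rev (sigma [:: c])).
  by rewrite (mor_cons sM) ea !rev_cat rev_cons -cats1 -!catA.
apply: (constant_after _ e); last by rewrite mem_cat !mem_rev hc orbT.
move=> v; rewrite -infix_revLR => vl.
have /E[//|e'] : exists z, infix [:: v; l'] (sigma [:: c; z]) \/
    infix [:: v; l'] (sigma [:: z; c]) by exists a; left.
by case: ll.
Qed.

End StarAt.

(* Abstract form of the case where the last letters G a of the images of
   letters agree; F a are their first letters and I the pairs inside them. *)
Lemma const_star (A B : Type) (ell G F : A -> B) (I : B -> B -> Prop) :
  (forall c a, (G c = ell c \/ F a = ell c) /\ (G a = ell c \/ F c = ell c)) ->
  (forall u v, I u v -> forall c, u = ell c \/ v = ell c) ->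
  (forall c, I (ell c) (ell c) \/ exists z z', ell c = G z /\ ell c = F z') ->
  (forall a b, G a = G b) -> forall c d, ell c = ell d.
Proof.
move=> bd inn full Gc.
have [GE|/existsNP[c0 c0G]] := pselect (forall c, ell c = G c).
  by move=> c d; rewrite !GE.
have Fp a : F a = ell c0 by have [[e|//] _] := bd c0 a; case: c0G.
suff H d : ell d = ell c0 by move=> c d; rewrite !H.
apply: contrapT => dc.
have ed : ell d = G d.
  by have [[//|e] _] := bd d d; case: dc; rewrite -e Fp.
have [Id|[z [z' [_ e]]]] := full d; last by apply: dc; rewrite e Fp.
by have [e|e] := inn _ _ Id c0; apply: c0G; rewrite -e ed; apply: Gc.
Qed.

(** * Decoding finite words and peeling off one Arnoux-Rauzy morphism *)

Section Decoding.
Variables (B : finType) (l : B).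
Implicit Types (u w : seq B) (b : B).

Lemma AR_L_cons b u : AR_L l (b :: u) = (if b == l then [:: l] else [:: l; b]) ++ AR_L l u.
Proof. by []. Qed.

(** Two letters other than [l] are never adjacent, so the word splits into blocks [l] and [l e]. *)
Lemma AR_L_of_pairs w : (forall b c, infix [:: b; c] w -> b = l \/ c = l) ->
  head l w = l -> exists u, w = AR_L l u.
Proof.
move: {2}(size w) (leqnn (size w)) => n; elim: n w => [|n IHn] w.
  by case: w => // _ _ _; exists [::].
case: w => [|b w] wn wl /= eb; first by exists [::].
subst b; case: w wn wl => [|e w] wn wl.
  by exists [:: l]; rewrite AR_L_cons eqxx.
have sub w' : infix w' [:: l, e & w] -> forall b c, infix [:: b; c] w' -> b = l \/ c = l.
  by move=> w'w b c bc; apply: wl; apply: infix_trans bc w'w.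
have [el|el] := eqVneq e l.
  subst e; have [|||u eu] := IHn (l :: w) => //.
    by apply: sub; exact: infix_cons.
  by exists (l :: u); rewrite AR_L_cons eqxx eu.
have [|||u eu] := IHn w.
- by move: wn => /=; lia.
- by apply: sub; apply: infix_trans (infix_cons _ _) (infix_cons _ _).
- case: w wl {wn sub} => // f w wl /=.
  have [|e'|//] := wl e f; first by apply/infixP; exists [:: l], w.
  by rewrite e' eqxx in el.
by exists (e :: u); rewrite AR_L_cons (negPf el) -eu.
Qed.

Lemma rev_AR_L u : rev (AR_L l u) = AR_R l (rev u).
Proof.
elim: u => // b u IHu; rewrite AR_L_cons rev_cat IHu rev_cons.
by rewrite (mor_rcons (AR_R_morphism l)) /AR_R extend1; case: eqP.
Qed.

Lemma AR_L_mem b u : b \in AR_L l u -> b = l \/ b \in u.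
Proof.
elim: u => // c u IHu; rewrite AR_L_cons mem_cat => /orP[|/IHu[->|bu]]; last 2 first.
- by left.
- by right; rewrite inE bu orbT.
case: eqP => _; rewrite !inE; first by move/eqP; left.
by case/orP => [/eqP|->]; [left|right].
Qed.

Lemma AR_L_ll u : infix [:: l; l] (AR_L l u) -> l \in u.
Proof.
apply: contraLR => lu; pose r b c := ~~ ((b == l) && (c == l)).
have pr e : e != l -> path r e (AR_L l u).
  elim: u e lu => // c u IHu e; rewrite inE negb_or eq_sym => /andP[cl lu] el.
  by rewrite AR_L_cons (negPf cl) /= {1 2}/r (negPf cl) (negPf el) eqxx /= IHu.
case: u lu pr => // c u; rewrite inE negb_or eq_sym => /andP[cl _] /(_ c cl) /path_sorted so.
by apply/negP => /infix_sorted/(_ so); rewrite /= /r eqxx.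
Qed.

Lemma size_AR_L u : size (AR_L l u) = size u + count (predC1 l) u.
Proof.
elim: u => // c u IHu; rewrite AR_L_cons size_cat IHu /=.
by case: eqP => _ /=; lia.
Qed.

Lemma AR_R_mem b u : b \in AR_R l u -> b = l \/ b \in u.
Proof. by rewrite -[u in AR_R l u]revK -rev_AR_L mem_rev => /AR_L_mem; rewrite mem_rev. Qed.

Lemma AR_R_ll u : infix [:: l; l] (AR_R l u) -> l \in u.
Proof.
rewrite -[u in AR_R l u]revK -rev_AR_L -infix_revLR => /AR_L_ll.
by rewrite mem_rev.
Qed.

Lemma size_AR_R u : size (AR_R l u) = size u + count (predC1 l) u.
Proof. by rewrite -[u in AR_R l u]revK -rev_AR_L size_rev size_AR_L size_rev count_rev. Qed.

End Decoding.

(** Treats [AR_L] and [AR_R] at once through [M]. The factor [ll] ensures that [l] still occurs in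
    the peeled images, and the total length drops because a letter other than [l] occurs too. *)
Lemma peel (A B : finType) (l : B) (M : seq B -> seq B) (s : seq A -> seq B) (f : A -> seq B) :
  1 < #|B| -> is_morphism M ->
  (forall b u, b \in M u -> b = l \/ b \in u) ->
  (forall u, infix [:: l; l] (M u) -> l \in u) ->
  (forall u, size (M u) = size u + count (predC1 l) u) ->
  is_morphism s -> non_erasing s -> (forall a, s [:: a] = M (f a)) ->
  (exists w, infix [:: l; l] (s w)) ->
  [/\ is_morphism (extend f), non_erasing (extend f), s =1 M \o extend f &
      \sum_a size (extend f [:: a]) < \sum_a size (s [:: a])].
Proof.
move=> cB MM Mmem Mll Msz sM sN sf [w ll].
have sE w' : s w' = M (extend f w').
  elim: w' => [|a w' IHw]; first by rewrite (mor0 sM) (mor0 MM).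
  by rewrite (mor_cons sM) IHw sf -(mor_cat MM).
have fB b : exists a, b \in f a.
  have [->|bl] := eqVneq b l.
    move: ll; rewrite sE => /Mll /flatten_mapP[a _ la].
    by exists a.
  have [_ _ /(_ b)[a]] := sM; rewrite sf => /Mmem[e|bf]; last by exists a.
  by rewrite e eqxx in bl.
split=> //; first exact: extend_morphism.
- move=> a; rewrite extend1 => fa; apply: (sN a).
  by rewrite sf fa (mor0 MM).
have [b bl] : exists b : B, b != l.
  have /card_gt1P[b [b' [_ _ bb]]] := cB.
  by have [e|] := eqVneq b l; [exists b'; rewrite -e eq_sym | exists b].
have [a ba] := fB b.
have -> : \sum_a size (extend f [:: a]) = \sum_a size (f a).
  by apply: eq_bigr => c _; rewrite extend1.
have -> : \sum_a size (s [:: a]) = \sum_a size (f a) + \sum_a count (predC1 l) (f a).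
  by rewrite -big_split; apply: eq_bigr => c _; rewrite sf Msz.
rewrite -[X in X < _]addn0 ltn_add2l (bigD1 a) //= ltn_addr //.
by rewrite -has_count; apply/hasP; exists b.
Qed.

(** * Codings and factorizations *)

Lemma infix_nth2 (T : eqType) (x0 : T) w k : k.+1 < size w ->
  infix [:: nth x0 w k; nth x0 w k.+1] w.
Proof.
move=> kw; apply/infixP; exists (take k w), (drop k.+2 w).
by rewrite -[LHS](cat_take_drop k) (drop_nth x0 (ltnW kw)) (drop_nth x0 kw).
Qed.

Lemma alternating_nth (T : eqType) (p q x0 : T) w k :
  (forall u v, infix [:: u; v] w -> (u = p /\ v = q) \/ (u = q /\ v = p)) -> p <> q ->
  head x0 w = p -> k < size w -> nth x0 w k = if odd k then q else p.
Proof.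
move=> wa pq wp; elim: k => [|k IHk] kw; first by rewrite nth0.
have := wa _ _ (infix_nth2 x0 kw); rewrite IHk ?(ltnW kw) //=.
by case: (odd k) => /= -[[e ->]|[e ->]] //; case: pq.
Qed.

Section Structure.
Variables (A B : finType) (sigma : seq A -> seq B).
Hypotheses (cA : 1 < #|A|) (cB : 1 < #|B|).
Hypotheses (sM : is_morphism sigma) (sN : non_erasing sigma) (sD : dendric_preserving sigma).

Let pairs c u v :=
  exists z, infix [:: u; v] (sigma [:: c; z]) \/ infix [:: u; v] (sigma [:: z; c]).

(** Compare the centre [ell c] with the first letter [f c] and the last letter [g c] of the image of
    [c]. If [f] or [g] is constant, so is [ell]. Otherwise all three coincide and are injective, and
    an image of length at least 2 leaves only two alternating images, which a 4-cycle around [sigma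
    [:: a1]] excludes. *)
Lemma common_star_or_coding :
  (exists l, forall c u v, pairs c u v <-> u = l \/ v = l) \/
  (exists2 f : A -> B, injective f & forall a, sigma [:: a] = [:: f a]).
Proof.
have [ell ellP] : exists ell, forall c u v, pairs c u v <-> u = ell c \/ v = ell c.
  by have [ell e] := choice (star_at cA cB sM sN sD); exists ell.
have [a1 [a2 [_ _ a12]]] : exists a1 a2 : A, [/\ a1 \in A, a2 \in A & a1 != a2].
  exact/card_gt1P.
have [b0 _] : exists b0 : B, True by have /card_gt1P[b _] := cB; exists b.
pose f a := head b0 (sigma [:: a]); pose g a := last b0 (sigma [:: a]).
have sf a : exists r, sigma [:: a] = f a :: r.
  by rewrite /f; case: (sigma [:: a]) (@sN a) => // b r _; exists r.
have sg a : exists r, sigma [:: a] = rcons r (g a).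
  rewrite /g; case/lastP: (sigma [:: a]) (@sN a) => // r b _; exists r.
  by rewrite last_rcons.
have bd a b : infix [:: g a; f b] (sigma [:: a; b]).
  have [r1 e1] := sg a; have [r2 e2] := sf b.
  by rewrite (mor_cons sM) e1 e2; apply/infixP; exists r1, r2; rewrite cat_rcons.
pose I u v := exists a, infix [:: u; v] (sigma [:: a]).
have IP u v : I u v -> forall c, u = ell c \/ v = ell c.
  case=> a uv c; apply/ellP; exists a; left.
  by rewrite (mor_cons sM); apply: infix_catl.
have bdP c a : (g c = ell c \/ f a = ell c) /\ (g a = ell c \/ f c = ell c).
  by split; apply/ellP; exists a; [left|right]; apply: bd.
have full c u v : u = ell c \/ v = ell c -> I u v \/ exists z z', u = g z /\ v = f z'.
  suff H z z' : infix [:: u; v] (sigma [:: z; z']) -> I u v \/ exists z z', u = g z /\ v = f z'.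
    by case/ellP => z [|] /H.
  rewrite (mor_cons sM) => /infix2_cat[uv|uv|[r1 [r2 [e1 e2]]]].
  - by left; exists z.
  - by left; exists z'.
  right; exists z, z'; rewrite /g /f e1 e2 last_rcons; split=> //.
have const_ell : (forall c d, ell c = ell d) ->
    exists l, forall c u v, pairs c u v <-> u = l \/ v = l.
  by move=> el; exists (ell a1) => c u v; rewrite (el a1 c).
have [gc|gn] := pselect (forall a b, g a = g b).
  left; apply/const_ell/(const_star bdP IP) => // c.
  by apply: (full c); left.
have [fc|fn] := pselect (forall a b, f a = f b).
  left; apply/const_ell/(@const_star _ _ ell f g (fun u v => I v u)) => //.
  - by move=> c a; have [h1 h2] := bdP c a; split; apply/or_comm.
  - by move=> u v /IP h c; apply/or_comm.
  move=> c; have [||[z [z' [e1 e2]]]] := full c (ell c) (ell c); [by left|by left|].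
  by right; exists z', z.
have {}gn : exists a b, g a <> g b.
  by move/existsNP: gn => [a /existsNP[b ab]]; exists a, b.
have {}fn : exists a b, f a <> f b.
  by move/existsNP: fn => [a /existsNP[b ab]]; exists a, b.
(* The pair [g c], [f z] contains [ell c] for all [z]; were [g c] different from it, [f] would be
   constant. *)
have ge c : ell c = g c.
  apply: contrapT => ne; have [a [b ab]] := fn; apply: ab.
  have H z : f z = ell c by have [[e|//] _] := bdP c z; case: ne.
  by rewrite !H.
have fe c : ell c = f c.
  apply: contrapT => ne; have [a [b ab]] := gn; apply: ab.
  have H z : g z = ell c by have [_ [//|e]] := bdP c z; case: ne.
  by rewrite !H.
have ginj : injective g.
  apply: (left_letters_inj (w := [::]) _ gn fn) => x xA xD.
  have [y xy] := is_image_exists sM sN x; exists y; split; first exact: sD xy.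
  by move=> a b xab; apply/(image_factor sM sN xy); exists [:: a; b] => //; exact: bd.
have einj : injective ell by move=> a b; rewrite !ge => /ginj.
right; exists f => [a b|a]; first by rewrite -!fe => /einj.
(* A pair inside an image contains every centre [ell c]; the centres being distinct, [A] has just
   two letters. *)
have [r ra] := sf a; case: r ra => // b1 r ra; exfalso.
have I0 : I (f a) b1 by exists a; rewrite ra; apply/infixP; exists [::], r.
move: (f a) b1 I0 {ra} => u v I0 {r}.
set p := ell a1; set q := ell a2.
have pq : p <> q by move/einj/eqP; apply/negP.
have alt s t : I s t -> (s = p /\ t = q) \/ (s = q /\ t = p).
  move=> /IP st; have [e1|e1] := st a1; have [e2|e2] := st a2.
  - by case: pq; rewrite /p /q -e1 -e2.
  - by left.
  - by right.
  - by case: pq; rewrite /p /q -e1 -e2.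
have two z : z = a1 \/ z = a2.
  have [ez|ez] := IP _ _ I0 z; have [[eu ev]|[eu ev]] := alt _ _ I0.
  - by left; apply: einj; rewrite -ez eu.
  - by right; apply: einj; rewrite -ez eu.
  - by right; apply: einj; rewrite -ez ev.
  - by left; apply: einj; rewrite -ez ev.
pose n := size (sigma [:: a1]); pose m := size (sigma [:: a2]).
(* Pairs inside the images alternate between [p] and [q], and each image begins and ends with its
   own centre, so [Z] alternates throughout. *)
pose Z := sigma [:: a1; a2; a1].
have ZE : Z = sigma [:: a1] ++ sigma [:: a2] ++ sigma [:: a1].
  by rewrite /Z (mor_cons sM) (mor_cons sM a2).
have altZ s t : infix [:: s; t] Z -> (s = p /\ t = q) \/ (s = q /\ t = p).
  have bdy c d r1 r2 : sigma [:: c] = rcons r1 s -> sigma [:: d] = t :: r2 ->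
      s = ell c /\ t = ell d.
    by move=> ea eb; rewrite ge fe /g /f ea eb last_rcons.
  rewrite ZE => /infix2_cat[st|/infix2_cat[st|st|[r1 [r2 [e1 e2]]]]|[r1 [r2 [e1 e2]]]].
  - by apply: alt; exists a1.
  - by apply: alt; exists a2.
  - by apply: alt; exists a1.
  - by right; apply: bdy e1 e2.
  have [r3 e3] := sf a2; rewrite e3 in e2; case: e2 => e4 _; rewrite e4 in e3.
  by left; apply: bdy e1 e3.
have n0 : 0 < n by rewrite lt0n size_eq0; apply/eqP/sN.
have m0 : 0 < m by rewrite lt0n size_eq0; apply/eqP/sN.
have Zp : head b0 Z = p.
  by have [r e] := sf a1; rewrite ZE e /p fe.
have sZ : size Z = n + (m + n) by rewrite ZE !size_cat.
have nthZ k : k < size Z -> nth b0 Z k = if odd k then q else p.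
  exact: alternating_nth.
have n_odd : odd n.
  have : nth b0 Z n.-1 = p.
    by rewrite ZE nth_cat -/n ltn_predL n0 nth_last /p ge.
  rewrite nthZ; last by rewrite sZ; lia.
  by rewrite -{2}(prednK n0) /=; case: (odd n.-1) => // /esym.
have nm : 2 < n + m.
  case: I0 => c; have [->|->] := two c => uv.
    by have := size_infix uv; rewrite -/n /=; lia.
  by have := size_infix uv; rewrite -/m /=; lia.
have [x0 [x0A x0ds _]] := base_word cA.
have x0D : dendric x0 by move=> w /x0ds /double_star_tree.
have LM := AR_L_morphism a1; have LN := @AR_L_ne _ a1.
(* Two applications of [AR_L a1] produce the factors 111, 112, 211 and 121 in the indices of [a1],
   [a2]. The first three give the extensions [p p], [p q] and [q p] of [sigma [:: a1]]. *)
have [x1 x01] := is_image_exists LM LN x0; have [x2 x12] := is_image_exists LM LN x1.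
have [y x2y] := is_image_exists sM sN x2.
have x1A := image_over LM LN x01 x0A; have x2A := image_over LM LN x12 x1A.
have x1D := AR_L_preserving x0A x0D x01; have x2D := AR_L_preserving x1A x1D x12.
have yD := sD x2A x2D x2y.
have a21 : (a2 == a1) = false by rewrite eq_sym; apply/negbTE.
have x1p z : is_factor x1 [:: a1; z] by apply/(AR_L_pairs x01 x0A); left.
have im2 := image_factor LM LN x12; have imy := image_factor sM sN x2y.
have yext s t w : is_factor x2 w -> infix (s :: rcons (sigma [:: a1]) t) (sigma w) ->
    is_factor y (s :: rcons (sigma [:: a1]) t).
  by move=> xw sw; apply/imy; exists w.
have [rp ep] := sg a1; have [rp' ep'] := sf a1; rewrite -ge -/p in ep; rewrite -fe -/p in ep'.
have [rq eq] := sg a2; have [rq' eq'] := sf a2; rewrite -ge -/q in eq; rewrite -fe -/q in eq'.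
have three c d e : sigma [:: c; d; e] = sigma [:: c] ++ sigma [:: d] ++ sigma [:: e].
  by rewrite (mor_cons sM) (mor_cons sM d).
have around (w1 w2 w3 : seq B) s t r1 r3 : w1 = rcons r1 s -> w3 = t :: r3 ->
    infix (s :: rcons w2 t) (w1 ++ w2 ++ w3).
  move=> -> ->; apply/infixP; exists r1, r3.
  by rewrite cat_rcons /= cat_rcons.
have x2_111 : is_factor x2 [:: a1; a1; a1].
  have [e xe] := factor_extr (x1p a1); apply/im2; exists [:: a1; a1; e] => //.
  rewrite !AR_L_cons eqxx; apply/infixP; exists [::].
  by case: eqP => _; eexists; reflexivity.
have x2_112 : is_factor x2 [:: a1; a1; a2].
  apply/im2; exists [:: a1; a2] => //.
  by rewrite !AR_L_cons eqxx a21; apply/infixP; exists [::], [::].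
have x2_211 : is_factor x2 [:: a2; a1; a1].
  have x21 : is_factor x1 [:: a2; a1] by apply/(AR_L_pairs x01 x0A); right.
  have [e xe] := factor_extr x21; apply/im2; exists [:: a2; a1; e] => //.
  rewrite !AR_L_cons eqxx a21; apply/infixP; exists [:: a1].
  by case: eqP => _; eexists; reflexivity.
have x2_121 : is_factor x2 [:: a1; a2; a1].
  have [e xe] := factor_extr (factor1 x1A a2); apply/im2; exists [:: a2; e] => //.
  rewrite !AR_L_cons a21; apply/infixP; exists [::].
  by case: eqP => _; eexists; reflexivity.
apply: (dendric_cycle4 (w := sigma [:: a1]) yD pq pq).
- by apply: yext x2_111 _; rewrite three; apply: around ep ep'.
- by apply: yext x2_112 _; rewrite three; apply: around ep eq'.
- by apply: yext x2_211 _; rewrite three; apply: around eq ep'.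
apply: yext x2_121 _; rewrite -/Z.
(* The fourth extension lies in the alternating word [Z]: as [n] is odd, the [n.+2] letters from
   position 1 on are [q], [sigma [:: a1]], [q]. They fit since [n + m > 2]. *)
suff -> : q :: rcons (sigma [:: a1]) q = take n.+2 (drop 1 Z).
  by apply: infix_trans (infix_take _ _) (infix_drop _ _).
have st : size (take n.+2 (drop 1 Z)) = n.+2.
  by rewrite size_takel // size_drop sZ; lia.
apply: (@eq_from_nth _ b0); first by rewrite st /= size_rcons.
move=> k; rewrite /= size_rcons -/n => kn.
rewrite nth_take // nth_drop nthZ; last by rewrite sZ; lia.
case: k kn => // k kn; rewrite /= nth_rcons -/n.
case: ltngtP => [kn'|kn'|->]; [|by lia|by rewrite negbK n_odd].
have -> : nth b0 (sigma [:: a1]) k = nth b0 Z k by rewrite ZE nth_cat -/n kn'.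
by rewrite nthZ ?sZ ?negbK //; lia.
Qed.

End Structure.

(** * The two directions of the equivalence *)

Lemma AR_monoid_preserving (A : finType) (tau : seq A -> seq A) : AR_monoid tau ->
  [/\ is_morphism tau, non_erasing tau & dendric_preserving tau].
Proof.
elim=> [|l|l|s t _ [sM sN sD] _ [tM tN tD]].
- split=> [||x xA xD y xy]; [exact: id_morphism|by []|].
  suff -> : y = x by [].
  by apply/funext; exact: (is_image_unique (id_morphism A) _ xy (is_image_id x)).
- by split; [exact: AR_L_morphism|exact: AR_L_ne|exact: AR_L_preserving].
- by split; [exact: AR_R_morphism|exact: AR_R_ne|exact: AR_R_preserving].
split; [exact: is_morphism_comp|exact: non_erasing_comp|].
exact: dendric_preserving_comp.
Qed.

Lemma coding_map (A B : finType) (p : seq A -> seq B) (f : A -> B) :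
  is_morphism p -> (forall a, p [:: a] = [:: f a]) -> p = map f.
Proof.
move=> pM pf; apply/funext; elim=> [|a w IHw]; first exact: mor0 pM.
by rewrite (mor_cons pM) pf IHw.
Qed.

Lemma coding_preserving (A B : finType) (p : seq A -> seq B) :
  bijective_coding p -> dendric_preserving p.
Proof.
case=> pM [f fI pf] x xA xD y xy.
have pN : non_erasing p by move=> a; rewrite pf.
have pE := coding_map pM pf.
have fS b : exists a, b = f a.
  by have [_ _ /(_ b)[a]] := pM; rewrite pf inE => /eqP; exists a.
have [g gK] := choice fS; have fK : cancel f g by move=> a; apply: fI; rewrite -gK.
have win i n : window (f \o x) i n = map f (window x i n).
  by rewrite /window /mkseq -map_comp.
have -> : y = f \o x.
  apply/funext; apply: (is_image_unique pM pN xy) => n.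
  by rewrite pE; split => [u|v]; rewrite ?/u ?/v size_map size_window win.
have fac v : is_factor (f \o x) (map f v) <-> is_factor x v.
  by split=> -[i]; rewrite ?size_map ?win; [move/(inj_map fI)|move=> e]; exists i;
     rewrite ?size_map ?win ?e.
have {}fK := fK; move=> w; have -> : w = map f (map g w).
  by rewrite -map_comp -[LHS]map_id; apply: eq_map => b; rewrite /= -gK.
move: (map g w) => {}w /fac /xD.
pose F (u : A + A) : B + B := match u with inl a => inl (f a) | inr a => inr (f a) end.
pose G (u : B + B) : A + A := match u with inl a => inl (g a) | inr a => inr (g a) end.
have FK : cancel F G by case=> a; rewrite /F /G fK.
have GK : cancel G F by case=> b; rewrite /F /G -gK.
apply: (tree_iso FK GK).
  move=> [a|b]; rewrite !inE; apply: asbool_equiv_eq.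
    by rewrite -map_cons fac.
  by rewrite -map_rcons fac.
by move=> [a|b] [a'|b'] //=; apply: asbool_equiv_eq; rewrite -map_rcons -map_cons fac.
Qed.

(** Pulls an Arnoux-Rauzy morphism over [B] back through the coding to one over [A]. *)
Lemma AR_L_map (A B : finType) (f : A -> B) k u : injective f ->
  AR_L (f k) (map f u) = map f (AR_L k u).
Proof.
move=> fI; elim: u => // a u IHu; rewrite /= !AR_L_cons IHu map_cat (inj_eq fI).
by case: eqP.
Qed.

Lemma AR_R_map (A B : finType) (f : A -> B) k u : injective f ->
  AR_R (f k) (map f u) = map f (AR_R k u).
Proof.
move=> fI; rewrite -[u]revK; move: (rev u) => v.
by rewrite map_rev -!rev_AR_L map_rev AR_L_map.
Qed.

Lemma preserving_AR (A B : finType) (sigma : seq A -> seq B) : 1 < #|A| -> 1 < #|B| ->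
  is_morphism sigma -> non_erasing sigma -> dendric_preserving sigma ->
  exists (tau : seq A -> seq A) (pi : seq A -> seq B),
    [/\ AR_monoid tau, bijective_coding pi & sigma =1 pi \o tau].
Proof.
move=> cA cB; move: {2}(\sum_a _) (leqnn (\sum_a size (sigma [:: a]))) => n.
elim: n sigma => [|n IHn] sigma sn sM sN sD.
  have /card_gt1P[a _] := cA.
  case: (@sN a); apply: size0nil; apply/eqP; rewrite -leqn0.
  by apply: leq_trans sn; rewrite (bigD1 a) //= leq_addr.
have [[l lP]|[f fI sf]] := common_star_or_coding cA cB sM sN sD; last first.
  by exists (fun w => w), sigma; split=> //; [exact: AR_monoid_id|split=> //; exists f].
have /card_gt1P[a0 [_ [_ _ _]]] := cA.
have internal a b c : infix [:: b; c] (sigma [:: a]) -> b = l \/ c = l.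
  move=> bc; apply/(lP a0); exists a; left.
  by rewrite (mor_cons sM); apply: infix_catl.
have ll : exists w, infix [:: l; l] (sigma w).
  have [_ /(_ (or_introl erefl))[z]] := lP a0 l l.
  by case=> zl; eexists; exact: zl.
have finish (M : seq B -> seq B) (N : A -> seq A -> seq A) u :
    (forall k, AR_monoid (N k)) ->
    (forall (h : A -> B) k w, injective h -> h k = l -> M (map h w) = map h (N k w)) ->
    [/\ is_morphism (extend u), non_erasing (extend u), sigma =1 M \o extend u &
        \sum_a size (extend u [:: a]) < \sum_a size (sigma [:: a])] ->
    dendric_preserving (extend u) ->
    exists (tau : seq A -> seq A) (pi : seq A -> seq B),
      [/\ AR_monoid tau, bijective_coding pi & sigma =1 pi \o tau].
  move=> NAR MN [tM tN sE ts] tD.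
  have [|tau [pi [tauAR piC te]]] := IHn (extend u) _ tM tN tD.
    by rewrite -ltnS; apply: leq_trans ts sn.
  case: (piC) => piM [f fI pf]; have pE := coding_map piM pf.
  have [k lk] : exists k, f k = l.
    by have [_ _ /(_ l)[k]] := piM; rewrite pf inE => /eqP; exists k.
  exists (N k \o tau), pi; split=> //; first exact: AR_monoid_comp.
  by move=> w; rewrite sE /= te /= pE (MN _ k).
(* If some sigma(a) does not begin with [l], the pair at the junction of sigma(ba) shows that each
   sigma(b) ends with [l]. *)
have [/choice[u su]|/choice[u su]] : (forall a, exists u, sigma [:: a] = AR_L l u) \/
    (forall a, exists u, sigma [:: a] = AR_R l u).
  have [hl|/existsNP[a ha]] := pselect (forall a, head l (sigma [:: a]) = l).
    by left=> a; apply: AR_L_of_pairs => //; apply: internal.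
  right=> b; suff [v ev] : exists v, rev (sigma [:: b]) = AR_L l v.
    by exists (rev v); rewrite -rev_AR_L -ev revK.
  apply: AR_L_of_pairs.
    by move=> c d; rewrite -infix_revLR => /(internal _ d c) [->|->]; [right|left].
  have [r1 [c eb]] : exists r1 c, sigma [:: b] = rcons r1 c.
    by case/lastP: (sigma [:: b]) (@sN b) => // r1 c _; exists r1, c.
  have [d [r2 ea]] : exists d r2, sigma [:: a] = d :: r2.
    by case: (sigma [:: a]) (@sN a) => // d r2 _; exists d, r2.
  rewrite eb rev_rcons /=; rewrite ea /= in ha.
  have [//|//] : c = l \/ d = l.
  apply/(lP b); exists a; left; rewrite (mor_cons sM) eb ea.
  by apply/infixP; exists r1, r2; rewrite cat_rcons.
- have pl := peel cB (AR_L_morphism l) (@AR_L_mem _ l) (@AR_L_ll _ l)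
    (@size_AR_L _ l) sM sN su ll.
  apply: (finish _ (@AR_L A) u _ _ pl); first exact: AR_monoid_L.
    by move=> h k w hI <-; apply: AR_L_map.
  have [_ _ /funext sE _] := pl => x xA xD y xy.
  have [z yz] := is_image_exists (AR_L_morphism l) (@AR_L_ne _ l) y.
  apply: (AR_L_dendric_inv yz); apply: (sD x xA xD).
  by rewrite sE; apply: is_image_comp yz.
have pl := peel cB (AR_R_morphism l) (@AR_R_mem _ l) (@AR_R_ll _ l)
  (@size_AR_R _ l) sM sN su ll.
apply: (finish _ (@AR_R A) u _ _ pl); first exact: AR_monoid_R.
  by move=> h k w hI <-; apply: AR_R_map.
have [_ _ /funext sE _] := pl => x xA xD y xy.
have [z yz] := is_image_exists (AR_L_morphism l) (@AR_L_ne _ l) y.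
have [z' yz'] := is_image_exists (AR_R_morphism l) (@AR_R_ne _ l) y.
(* The images of [y] under [AR_R l] and [AR_L l] have the same factors, and the latter reflects
   dendricity. *)
apply: (AR_L_dendric_inv yz).
apply: (dendric_lang (fun w => iff_sym (AR_R_factor yz yz' w))); apply: (sD x xA xD).
by rewrite sE; apply: is_image_comp yz'.
Qed.

Theorem theorem28 (A B : finType) (cardA : (1 < #|A|)%N) (cardB : (1 < #|B|)%N)
    (sigma : seq A -> seq B)
    (sigma_mor : is_morphism sigma) (sigma_ne : non_erasing sigma) :
  dendric_preserving sigma <->
  exists (tau : seq A -> seq A) (pi : seq A -> seq B),
    [/\ AR_monoid tau, bijective_coding pi & sigma =1 pi \o tau].
Proof.
split=> [|[tau [pi [/AR_monoid_preserving[tM tN tD] piC /funext ->]]]].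
  exact: preserving_AR.
have [piM [f _ pf]] := piC.
apply: dendric_preserving_comp => //; last exact: coding_preserving.
by move=> a; rewrite pf.
Qed.
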